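(* Let $(X,\mathcal{R})$ be a $Q$-polynomial association scheme of class $3$, with relations $R_0,R_1,R_2,R_3$. Then $(X,\mathcal{R})$ is dual-tight if and only if, for some $i\neq 0$, the graph $(X,R_i)$ is the incidence graph of a symmetric design.
   Context: $(X,\mathcal{R})$ is a (symmetric) association scheme on a finite set $X$ with relations $R_0,\ldots,R_D$, adjacency matrices $A_0=I,A_1,\ldots,A_D$ and primitive idempotents $E_0=\frac{1}{|X|}J,E_1,\ldots,E_D$. Krein parameters $q_{i,j}^h$ are defined by $E_i\circ E_j=\frac{1}{|X|}\sum_{h=0}^D q_{i,j}^h E_h$ ($\circ$ the entrywise product). The scheme is $Q$-polynomial with respect to $E_0,\ldots,E_D$ if $q_{1,j}^h=0$ whenever $|h-j|>1$ and $q_{1,j}^h\neq0$ whenever $|h-j|=1$. Set $a_i^*=q_{1,i}^i$, $b_i^*=q_{1,i+1}^i$, $c_i^*=q_{1,i-1}^i$, $m=q_{1,1}^0=\operatorname{rank}E_1$. The dual eigenvalues $\theta_h^*$ are defined by $E_1=\frac{1}{|X|}\sum_h\theta_h^*A_h$, indexed so that $\theta_0^*=m>\theta_1^*>\cdots>\theta_D^*$. The scheme is $Q$-bipartite if $a_i^*=0$ for all $i$. It is called dual-tight if it is not $Q$-bipartite and $$\Big(\theta_1^*+\frac{m}{a_1^*+1}\Big)\Big(\theta_D^*+\frac{m}{a_1^*+1}\Big)= -\frac{m a_1^* b_1^*}{(a_1^*+1)^2}$$ (the left side is always $\geq$ the right side). The incidence graph of a symmetric design is the bipartite graph whose vertices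 are the points and blocks of the design, a point adjacent to a block iff incident.
   Formalization: ''Symmetric design'' is taken to be nontrivial, with block size k satisfying 2 ≤ k ≤ v−2; if trivial designs were allowed the ''if'' direction fails, e.g. the hexagon (2-(3,2,1) design) gives a Q-bipartite, hence not dual-tight, scheme. *)

(* Defs.v *)
From HB Require Import structures.
From mathcomp Require Import all_boot all_order all_algebra.

Set Implicit Arguments.
Unset Strict Implicit.
Unset Printing Implicit Defensive.

Import Order.TTheory GRing.Theory Num.Theory.
Local Open Scope ring_scope.

Section AssociationScheme.
Variables (D : nat) (X : finType) (r : 'I_D.+1 -> rel X).

Definition association_scheme : Prop :=
  [/\ forall x y : X, r ord0 x y = (x == y),
      forall x y : X, exists! i : 'I_D.+1, r i x y,
      forall i : 'I_D.+1, exists x y : X, r i x y,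
      forall (i : 'I_D.+1) (x y : X), r i x y = r i y x
    & exists p : 'I_D.+1 -> 'I_D.+1 -> 'I_D.+1 -> nat,
        forall (h i j : 'I_D.+1) (x y : X), r h x y ->
          #|[set z | r i x z && r j z y]| = p h i j].

Variable R : rcfType.

(* Matrices indexed by X are square matrices of order #|X|, rows and columns
   being numbered by the enumeration enum_val of X. *)
Definition adjacency (i : 'I_D.+1) : 'M[R]_#|X| :=
  \matrix_(x, y) (r i (enum_val x) (enum_val y))%:R.

Definition bose_mesner (M : 'M[R]_#|X|) : Prop :=
  exists c : 'I_D.+1 -> R, M = \sum_i c i *: adjacency i.

Definition bm_idempotent (M : 'M[R]_#|X|) : Prop :=
  bose_mesner M /\ M *m M = M.

Definition primitive_idempotent (M : 'M[R]_#|X|) : Prop :=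
  [/\ bm_idempotent M, M <> 0
    & forall F G : 'M[R]_#|X|, bm_idempotent F -> bm_idempotent G ->
        F *m G = 0 -> M = F + G -> F = 0 \/ G = 0].

(* The Bose-Mesner algebra, of dimension D + 1, has exactly D + 1 primitive
   idempotents, so an injective family indexed by 'I_D.+1 lists them all. *)
Definition primitive_idempotents (E : 'I_D.+1 -> 'M[R]_#|X|) : Prop :=
  [/\ E ord0 = const_mx (#|X|%:R^-1),
      forall i, primitive_idempotent (E i)
    & injective E].

(* q i j h is the Krein parameter with lower indices i, j and upper index h. *)
Definition krein_parameters (E : 'I_D.+1 -> 'M[R]_#|X|)
    (q : 'I_D.+1 -> 'I_D.+1 -> 'I_D.+1 -> R) : Prop :=
  forall i j, map2_mx *%R (E i) (E j) = #|X|%:R^-1 *: \sum_h q i j h *: E h.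

Definition dual_eigenvalues (E : 'I_D.+1 -> 'M[R]_#|X|)
    (theta : 'I_D.+1 -> R) : Prop :=
  E (inord 1) = #|X|%:R^-1 *: \sum_h theta h *: adjacency h.

End AssociationScheme.

Section QPolynomial.
Variables (D : nat) (R : rcfType).
Variables (q : 'I_D.+1 -> 'I_D.+1 -> 'I_D.+1 -> R) (theta : 'I_D.+1 -> R).

Definition q_polynomial : Prop :=
  forall h j : 'I_D.+1,
    ((1 < `|h - j|)%N -> q (inord 1) j h = 0) /\
    (`|h - j|%N = 1%N -> q (inord 1) j h <> 0).

Definition dual_eigenvalues_decreasing : Prop :=
  forall i j : 'I_D.+1, (i < j)%N -> theta j < theta i.

Definition astar (i : 'I_D.+1) : R := q (inord 1) i i.
(* Meaningful for i < D only: inord sends D + 1 to 0. *)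
Definition bstar (i : 'I_D.+1) : R := q (inord 1) (inord i.+1) i.
Definition mult : R := q (inord 1) (inord 1) ord0.

Definition q_bipartite : Prop := forall i, astar i = 0.

Definition dual_tight : Prop :=
  let a1 := astar (inord 1) in
  let b1 := bstar (inord 1) in
  let m := mult in
  ~ q_bipartite /\
  (theta (inord 1) + m / (a1 + 1)) * (theta ord_max + m / (a1 + 1)) =
    - (m * a1 * b1) / (a1 + 1) ^+ 2.

End QPolynomial.

(* Symmetric 2-(v, k, l) designs, with the usual non-degeneracy convention
   2 <= k <= v - 2. Excluding the blocks of size 1 and v - 1 matters here: the
   icosahedron has a perfect matching as a relation, and K_{n,n} minus a perfect
   matching (n >= 3) is the incidence graph of the 2-(n, n - 1, n - 2) design,
   while both give Q-bipartite, hence not dual-tight, Q-polynomial schemes. *)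
Definition symmetric_design (P B : finType) (inc : P -> B -> bool)
    (v k l : nat) : Prop :=
  [/\ #|P| = v /\ #|B| = v,
      (1 < k)%N && (k.+1 < v)%N,
      forall b : B, #|[set p | inc p b]| = k
    & forall p p' : P, p != p' -> #|[set b | inc p b && inc p' b]| = l].

Definition incidence_graph (P B : finType) (inc : P -> B -> bool) :
    rel (P + B)%type :=
  fun x y => match x, y with
             | inl p, inr b | inr b, inl p => inc p b
             | _, _ => false
             end.

Definition graph_iso (V W : finType) (e : rel V) (e' : rel W) : Prop :=
  exists2 f : V -> W, bijective f & forall x y, e' (f x) (f y) = e x y.

Definition is_symmetric_design_graph (X : finType) (e : rel X) : Prop :=
  exists (P B : finType) (inc : P -> B -> bool) (v k l : nat),
    symmetric_design inc v k l /\ graph_iso (incidence_graph inc) e.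

(* Main.v *)
Require Import Defs.
From mathcomp Require Import all_boot all_order all_algebra.
From mathcomp Require Import ring lra.

Set Implicit Arguments.
Unset Strict Implicit.
Unset Printing Implicit Defensive.

Import Order.TTheory GRing.Theory Num.Theory.
Local Open Scope ring_scope.

(* Write n E_j = sum_h Q_j(h) A_h, so that Q_1 = theta^*. If the scheme is
   dual-tight, then the numbers
   p^h_{13} k_h (m theta^*_h - theta^*_1 theta^*_3)^2 sum to 0, hence A_1 A_3
   is a multiple of a single A_h, and Q_j(1) Q_j(3) = Q_j(0) Q_j(h) for all j.
   The recurrence of the Q_j excludes h = 1 and h = 3, and for h = 2 it gives
   a_3^* = 0, b_2^* = (theta^*_2)^2 and a_2^* = - a_1^* theta^*_2.
   Nonnegativity of the Krein parameters q_{22}^3 and q_{33}^3 then forces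
   theta^*_2 = -1 and Q_3 = (1, -1, 1, -1), so n E_3 is a rank one sign matrix,
   which splits X into points and blocks.
   Conversely, the sign matrix of the bipartition of a design is n E_l for some
   l. Entrywise multiplication by it is an algebra automorphism, so q_{1l}^h is
   0 or 1; this forces l = 3, and Q_2 = Q_1 Q_3 determines all dual
   eigenvalues. *)

(** * Bose-Mesner algebra *)

(** Packs the relations into one colouring [c] of the pairs, so that an element of the Bose-Mesner
    algebra becomes a function of the colour. *)
Lemma relation_index (D : nat) (X : finType) (r : 'I_D.+1 -> rel X) :
  association_scheme r ->
  exists c : X -> X -> 'I_D.+1,
    [/\ forall i x y, r i x y = (c x y == i),
        forall x y, (c x y == ord0) = (x == y),
        forall x y, c x y = c y x,
        forall i, exists x y, c x y = i
      & exists p : 'I_D.+1 -> 'I_D.+1 -> 'I_D.+1 -> nat,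
          forall i j x y,
            #|[set z | (c x z == i) && (c z y == j)]| = p (c x y) i j].
Proof.
case=> r0 rU rE rC [p pP].
have [c0 cP] : exists c : X * X -> 'I_D.+1,
    forall xy, unique (fun i => r i xy.1 xy.2) (c xy).
  apply: (fin_all_exists (U := fun=> 'I_D.+1)
    (P := fun xy => unique (fun i => r i xy.1 xy.2))) => -[x y].
  by have [i] := rU x y; exists i.
pose c x y := c0 (x, y).
have rc i x y : r i x y = (c x y == i).
  have [h1 h2] := cP (x, y); apply/idP/eqP => [/h2 //|<-]; exact: h1.
exists c; split=> //.
- by move=> x y; rewrite -rc r0.
- by move=> x y; apply/eqP; rewrite -rc rC rc.
- by move=> i; have [x [y]] := rE i; rewrite rc => /eqP; exists x, y.
exists p => i j x y; rewrite -(pP (c x y) i j x y) ?rc //.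
by apply: eq_card => z; rewrite !inE !rc.
Qed.

Section BoseMesner.

Variables (R : rcfType) (D : nat) (X : finType) (r : 'I_D.+1 -> rel X).
Variables (c : X -> X -> 'I_D.+1) (p : 'I_D.+1 -> 'I_D.+1 -> 'I_D.+1 -> nat).
Hypotheses (rc : forall i x y, r i x y = (c x y == i))
  (c0 : forall x y, (c x y == ord0) = (x == y))
  (cC : forall x y, c x y = c y x)
  (cE : forall i, exists x y, c x y = i)
  (cp : forall i j x y,
     #|[set z | (c x z == i) && (c z y == j)]| = p (c x y) i j).

Local Notation n := (#|X|%:R : R).
Local Notation A := (adjacency r R).

(** By symmetry, p^0_{hh} counts the z that are R_h-related to a fixed x. *)
Definition valency (h : 'I_D.+1) : nat := p ord0 h h.
Local Notation k := valency.

(** Coordinates in the basis of adjacency matrices: entrywise products become pointwise products of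
    coordinates. *)
Definition bm (f : 'I_D.+1 -> R) : 'M[R]_#|X| :=
  \matrix_(x, y) f (c (enum_val x) (enum_val y)).

(** The common row sum of [bm f]. On a product f g it is the diagonal entry of [bm f *m bm g], hence
    the trace form up to the factor n. *)
Definition moment (f : 'I_D.+1 -> R) : R := \sum_h (k h)%:R * f h.

Lemma sum_enum_val (F : X -> R) :
  \sum_(z < #|X|) F (enum_val z) = \sum_z F z.
Proof. by rewrite (big_enum_val (A := X)). Qed.

Lemma bmE f x y : bm f (enum_rank x) (enum_rank y) = f (c x y).
Proof. by rewrite mxE !enum_rankK. Qed.

Lemma bmE_adj f : bm f = \sum_h f h *: A h.
Proof.
apply/matrixP => x y; rewrite mxE summxE.
rewrite (bigD1 (c (enum_val x) (enum_val y))) //= big1 => [|h hh].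
  by rewrite !mxE rc eqxx mulr1 addr0.
by rewrite !mxE rc eq_sym (negPf hh) mulr0.
Qed.

Lemma adjE h : A h = bm (fun i => (i == h)%:R).
Proof. by apply/matrixP => x y; rewrite !mxE rc. Qed.

Lemma bmP M : bose_mesner r M <-> exists f, M = bm f.
Proof. by split=> -[f ->]; exists f; rewrite bmE_adj. Qed.

Lemma bm_inj f g : bm f = bm g -> f =1 g.
Proof. by move=> efg i; have [x [y <-]] := cE i; rewrite -!bmE efg. Qed.

Lemma bmM f g :
  bm f *m bm g = bm (fun h => \sum_i \sum_j (p h i j)%:R * (f i * g j)).
Proof.
apply/matrixP => x y; rewrite !mxE.
under eq_bigr do rewrite !mxE.
rewrite (sum_enum_val (fun z => f (c (enum_val x) z) * g (c z (enum_val y)))).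
move: (enum_val x) (enum_val y) => {}x {}y.
under [RHS]eq_bigr do under eq_bigr do
  rewrite -cp cardsE -sum1_card natr_sum mulr_suml big_mkcond.
rewrite [RHS](eq_bigr (fun i => \sum_z \sum_j
    (if (c x z == i) && (c z y == j) then f i * g j else 0))).
  rewrite [RHS]exchange_big; apply: eq_bigr => z _.
  rewrite (bigD1 (c x z)) //= [X in _ = _ + X]big1 => [|i hi].
    rewrite (bigD1 (c z y)) //= [X in _ = _ + X + _]big1 => [|j hj].
      by rewrite !eqxx !addr0.
    by rewrite [_ == j]eq_sym (negPf hj) andbF.
  by rewrite big1 // => j _; rewrite [_ == i]eq_sym (negPf hi).
move=> i _; rewrite exchange_big; apply: eq_bigr => j _.
by apply: eq_bigr => z _; rewrite unfold_in mul1r.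
Qed.

Lemma p_sym h i j : p h i j = p h j i.
Proof.
have [x [y <-]] := cE h; rewrite -cp cC -cp.
by apply: eq_card => z; rewrite !inE andbC (cC y) (cC x z).
Qed.

Lemma bmMC f g : bm f *m bm g = bm g *m bm f.
Proof.
rewrite !bmM; apply/matrixP => x y; rewrite !mxE exchange_big /=.
by apply: eq_bigr => i _; apply: eq_bigr => j _; rewrite p_sym [f _ * _]mulrC.
Qed.

Lemma bm_hadamard f g : map2_mx *%R (bm f) (bm g) = bm (fun h => f h * g h).
Proof. by apply/matrixP => x y; rewrite !mxE. Qed.

Lemma bmZ a f : a *: bm f = bm (fun h => a * f h).
Proof. by apply/matrixP => x y; rewrite !mxE. Qed.

Lemma bm_sum (I : finType) (F : I -> 'I_D.+1 -> R) :
  \sum_i bm (F i) = bm (fun h => \sum_i F i h).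
Proof.
by apply/matrixP => x y; rewrite summxE !mxE; under eq_bigr do rewrite mxE.
Qed.

Lemma bm_sumE (I : finType) (a : I -> R) (F : I -> 'I_D.+1 -> R) :
  \sum_i a i *: bm (F i) = bm (fun h => \sum_i a i * F i h).
Proof. by rewrite -bm_sum; apply: eq_bigr => i _; rewrite bmZ. Qed.

Lemma card_ball x h : #|[set z | c x z == h]| = k h.
Proof.
rewrite /valency; have /eqP <- : c x x == ord0 by rewrite c0.
rewrite -cp; apply: eq_card => z; rewrite !inE (cC z).
by case: eqP.
Qed.

Lemma valency_gt0 h : (0 < k h)%N.
Proof.
have [x [y cxy]] := cE h; rewrite -(card_ball x) card_gt0.
by apply/set0Pn; exists y; rewrite inE cxy.
Qed.

Lemma n_gt0 : 0 < n.
Proof. by have [x _] := cE ord0; rewrite ltr0n; apply/card_gt0P; exists x. Qed.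

Lemma valency0 : k ord0 = 1%N.
Proof.
have [x _] := cE ord0; rewrite -(card_ball x) -(cards1 x).
by apply: eq_card => z; rewrite !inE c0 eq_sym.
Qed.

Lemma sum_relation (f : 'I_D.+1 -> R) x : \sum_z f (c x z) = moment f.
Proof.
rewrite (partition_big (c x) predT) //=; apply: eq_bigr => h _.
rewrite (eq_bigr (fun=> f h)) => [|z /eqP -> //].
by rewrite sumr_const -(card_ball x) mulr_natl cardsE.
Qed.

Lemma momentE (f g : 'I_D.+1 -> R) : f =1 g -> moment f = moment g.
Proof. by move=> fg; apply: eq_bigr => h _; rewrite fg. Qed.

Lemma bmM_diag f g x : (bm f *m bm g) x x = moment (fun h => f h * g h).
Proof.
rewrite mxE; under eq_bigr do rewrite !mxE.
rewrite (sum_enum_val (fun z => f (c (enum_val x) z) * g (c z (enum_val x)))).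
rewrite -(sum_relation _ (enum_val x)).
by apply: eq_bigr => z _; rewrite (cC z).
Qed.

Lemma bm_diag f x : bm f x x = f ord0.
Proof. by rewrite mxE; congr f; apply/eqP; rewrite c0. Qed.

Lemma bm1 : 1%:M = bm (fun h => (h == ord0)%:R).
Proof. by apply/matrixP => x y; rewrite !mxE c0 (inj_eq enum_val_inj). Qed.

Lemma adjM i j : A i *m A j = \sum_h (p h i j)%:R *: A h.
Proof.
rewrite -bmE_adj !adjE bmM; apply/matrixP => x y; rewrite !mxE.
rewrite (bigD1 i) //= [X in _ + X]big1 => [|i' ii'].
  rewrite (bigD1 j) //= [X in _ + X + _]big1 => [|j' jj'].
    by rewrite !eqxx !addr0 !mulr1.
  by rewrite (negPf jj') !mulr0.
by rewrite big1 // => j' _; rewrite (negPf ii') mul0r mulr0.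
Qed.

(** * Orthogonality of the primitive idempotents *)

Lemma bm_idempotentM (F G : 'M[R]_#|X|) :
  bm_idempotent r F -> bm_idempotent r G ->
  F *m G = G *m F /\ bm_idempotent r (F *m G).
Proof.
move=> [/bmP[f ->] ff] [/bmP[g ->] gg]; split; first exact: bmMC.
split; first by apply/bmP; rewrite bmM; eexists.
by rewrite mulmxA -(mulmxA (bm f)) (bmMC g) mulmxA ff -mulmxA gg.
Qed.

Lemma bm_idempotentB (F G : 'M[R]_#|X|) :
  bm_idempotent r F -> bm_idempotent r G -> F *m G = G ->
  bm_idempotent r (F - G).
Proof.
move=> iF iG FG; have [FGC _] := bm_idempotentM iF iG.
case: iF iG => [/bmP[f fE] ff] [/bmP[g gE] gg]; split; last first.
  by rewrite mulmxBl !mulmxBr ff gg -FGC FG subrr subr0.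
apply/bmP; exists (fun h => f h - g h); rewrite fE gE.
by apply/matrixP => x y; rewrite !mxE.
Qed.

(** F = F G + (F - F G) splits F into two orthogonal idempotents of the algebra, so primitivity
    kills one of them. *)
Lemma primitive_idempotent_absorb (F G : 'M[R]_#|X|) :
  primitive_idempotent r F -> bm_idempotent r G ->
  F *m G = 0 \/ F *m G = F.
Proof.
move=> [iF _ F1] iG; have [FGC iFG] := bm_idempotentM iF iG.
have FFG : F *m (F *m G) = F *m G by rewrite mulmxA iF.2.
have := F1 _ _ iFG (bm_idempotentB iF iFG FFG).
case.
- by rewrite mulmxBr -mulmxA -FGC FFG iFG.2 subrr.
- by rewrite addrC subrK.
- by left.
- by move/eqP; rewrite subr_eq0 => /eqP <-; right.
Qed.

Variables (E : 'I_D.+1 -> 'M[R]_#|X|).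
Hypothesis EP : primitive_idempotents r E.

Lemma idem_bm i : bm_idempotent r (E i).
Proof. by case: EP => _ /(_ i)[]. Qed.

Lemma idem_neq0 i : E i != 0.
Proof. by apply/eqP; case: EP => _ /(_ i)[]. Qed.

(** Two primitive idempotents with nonzero product absorb each other; commutativity makes them
    equal, against the injectivity of [E]. *)
Lemma idem_orth i j : E i *m E j = (i == j)%:R *: E i.
Proof.
have [_ prim inj] := EP.
case: eqP => [<-|ij]; first by rewrite scale1r (idem_bm i).2.
rewrite scale0r.
case: (primitive_idempotent_absorb (prim i) (idem_bm j)) => // Eij.
case: (primitive_idempotent_absorb (prim j) (idem_bm i)) => Eji.
  by rewrite (bm_idempotentM (idem_bm i) (idem_bm j)).1.
case: ij; apply: inj.
by rewrite -Eij (bm_idempotentM (idem_bm i) (idem_bm j)).1.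
Qed.

(** * The second eigenmatrix Q and its orthogonality relations *)

Variable Q : 'I_D.+1 -> 'I_D.+1 -> R.
Hypothesis EQ : forall j, E j = n^-1 *: bm (Q j).

Lemma n_neq0 : n != 0.
Proof. by rewrite gt_eqF ?n_gt0. Qed.

(** Orthogonality makes the D + 1 nonzero idempotents linearly independent, so the square matrix of
    their coordinates is invertible. *)
Lemma bm_span f : exists a : 'I_D.+1 -> R, bm f = \sum_j a j *: E j.
Proof.
pose C : 'M[R]_D.+1 := \matrix_(j, h) (n^-1 * Q j h).
have CE (u : 'rV[R]_D.+1) : \sum_j u 0 j *: E j = bm (fun h => (u *m C) 0 h).
  under eq_bigr do rewrite EQ bmZ.
  rewrite bm_sumE; apply/matrixP => x y; rewrite !mxE.
  by apply: eq_bigr => j _; rewrite mxE.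
have Cu : C \in unitmx.
  rewrite -row_free_unit; apply: inj_row_free => u uC.
  apply/rowP => i; rewrite mxE.
  have : E i *m \sum_j u 0 j *: E j = 0.
    rewrite CE uC (_ : bm _ = 0) ?mulmx0 //.
    by apply/matrixP => x y; rewrite !mxE.
  rewrite mulmx_sumr (bigD1 i) //= big1 => [|j ji]; last first.
    by rewrite -scalemxAr idem_orth eq_sym (negPf ji) scale0r scaler0.
  rewrite addr0 -scalemxAr idem_orth eqxx scale1r => /eqP.
  by rewrite scaler_eq0 (negPf (idem_neq0 i)) orbF => /eqP.
exists (fun j => (\row_h f h *m invmx C) 0 j).
by rewrite CE mulmxKV //; apply/matrixP => x y; rewrite !mxE.
Qed.

(** Compares diagonal entries in E_i E_j = delta_{ij} E_i. *)
Lemma moment_orth i j :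
  moment (fun h => Q i h * Q j h) = (i == j)%:R * n * Q i ord0.
Proof.
have [x _] := cE ord0.
have := idem_orth i j; rewrite !EQ -scalemxAl -scalemxAr.
move=> /(congr1 (fun M : 'M[R]_#|X| => M (enum_rank x) (enum_rank x))).
rewrite 2!mxE bmM_diag [in RHS]mxE [(_ *: bm _) _ _]mxE bm_diag => e.
have -> : moment (fun h => Q i h * Q j h) =
    n * (n * (n^-1 * (n^-1 * moment (fun h => Q i h * Q j h)))).
  by rewrite !mulVKf ?n_neq0.
by rewrite e; case: eqP => _; rewrite ?mul0r ?mulr0 // !mul1r mulVKf ?n_neq0.
Qed.

Lemma moment_gt0 f h : (forall h, 0 <= f h) -> 0 < f h -> 0 < moment f.
Proof.
move=> f0 fh; rewrite /moment (bigD1 h) //=; apply: ltr_pwDl.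
  by rewrite mulr_gt0 // ltr0n valency_gt0.
by apply: sumr_ge0 => i _; rewrite mulr_ge0 ?ler0n.
Qed.

(** By orthogonality n Q_j(0) is a weighted sum of squares of the Q_j(h), and these do not all
    vanish because E_j is nonzero. *)
Lemma Q0_gt0 j : 0 < Q j ord0.
Proof.
rewrite -(pmulr_rgt0 _ n_gt0); have := moment_orth j j.
rewrite eqxx mul1r => <-.
have [h Qh | Q0] := pickP (fun h => Q j h != 0).
  apply: (@moment_gt0 _ h) => [i|]; first by rewrite -expr2 sqr_ge0.
  by rewrite -expr2 lt_def sqr_ge0 andbT sqrf_eq0.
case/eqP: (idem_neq0 j); rewrite EQ; apply/matrixP => x y; rewrite !mxE.
by have /eqP-> := negbFE (Q0 (c (enum_val x) (enum_val y))); rewrite mulr0.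
Qed.

(** Each element of the algebra acts on E_j as a scalar because the idempotents span; a diagonal
    entry reveals the scalar. *)
Lemma bmM_idem f j :
  bm f *m E j = (moment (fun h => f h * Q j h) / Q j ord0) *: E j.
Proof.
have [a fa] := bm_span f.
have aj : bm f *m E j = a j *: E j.
  rewrite fa mulmx_suml (bigD1 j) //= big1 => [|i ij].
    by rewrite -scalemxAl idem_orth eqxx scale1r addr0.
  by rewrite -scalemxAl idem_orth (negPf ij) scale0r scaler0.
have [x _] := cE ord0.
have e := congr1 (fun M : 'M[R]_#|X| => M (enum_rank x) (enum_rank x)) aj.
rewrite EQ -scalemxAr mxE bmM_diag mxE [(_ *: bm _) _ _]mxE bm_diag in e.
rewrite aj; congr (_ *: _).
have -> : moment (fun h => f h * Q j h) =
    n * (n^-1 * (moment (fun h => f h * Q j h))) by rewrite mulVKf ?n_neq0.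
rewrite e [a j * _]mulrCA mulVKf ?n_neq0 ?mulfK //.
by rewrite gt_eqF ?Q0_gt0.
Qed.

Lemma sum_idem : \sum_j E j = 1%:M.
Proof.
have [a] := bm_span (fun h => (h == ord0)%:R); rewrite -bm1 => aE.
rewrite [RHS]aE; apply: eq_bigr => j _.
suff -> : a j = 1 by rewrite scale1r.
have /eqP := mulmx1 (E j); rewrite aE mulmx_sumr (bigD1 j) //= big1 => [|i ij].
  rewrite -scalemxAr idem_orth eqxx scale1r addr0 -subr_eq0.
  rewrite -{2}[E j]scale1r -scalerBl scaler_eq0 (negPf (idem_neq0 j)) orbF.
  by rewrite subr_eq0 => /eqP.
by rewrite -scalemxAr idem_orth eq_sym (negPf ij) scale0r scaler0.
Qed.

Lemma sum_Q h : \sum_j Q j h = (h == ord0)%:R * n.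
Proof.
have := sum_idem; under eq_bigr do rewrite EQ.
rewrite bm_sumE bm1 => /bm_inj/(_ h) <-.
by rewrite -mulr_sumr mulrAC mulVf ?mul1r ?n_neq0.
Qed.

Lemma moment_adj i f : moment (fun h => (h == i)%:R * f h) = (k i)%:R * f i.
Proof.
rewrite /moment (bigD1 i) //= big1 => [|h hi].
  by rewrite eqxx mul1r addr0.
by rewrite (negPf hi) mul0r mulr0.
Qed.

Lemma adjM_idem i j : A i *m E j = ((k i)%:R * Q j i / Q j ord0) *: E j.
Proof. by rewrite adjE bmM_idem moment_adj. Qed.

(** Both sides come from the action of A_i A_{i'} on E_j, once expanded by intersection numbers and
    once factor by factor. *)
Lemma moment_p i i' j :
  moment (fun h => (p h i i')%:R * Q j h) * Q j ord0 =
  (k i)%:R * (k i')%:R * (Q j i * Q j i').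
Proof.
have Qj := lt0r_neq0 (Q0_gt0 j).
have := mulmxA (A i) (A i') (E j).
rewrite adjM_idem -scalemxAr adjM_idem scalerA adjM mulmx_suml.
rewrite (eq_bigr (fun h =>
  ((p h i i')%:R * ((k h)%:R * Q j h / Q j ord0)) *: E j)); last first.
  by move=> h _; rewrite -scalemxAl adjM_idem scalerA.
rewrite -scaler_suml => /eqP; rewrite -subr_eq0 -scalerBl scaler_eq0.
rewrite (negPf (idem_neq0 j)) orbF subr_eq0 => /eqP e.
have -> : moment (fun h => (p h i i')%:R * Q j h) = Q j ord0 *
    \sum_h (p h i i')%:R * ((k h)%:R * Q j h / Q j ord0).
  by rewrite mulr_sumr; apply: eq_bigr => h _; field.
by rewrite -e; field.
Qed.

(* The sum over all x, y of E_i(x,y) E_j(x,y) E_l(x,y) is a sum of squares,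
   since each E is a symmetric idempotent. *)
Lemma moment3_ge0 i j l : 0 <= moment (fun h => Q i h * Q j h * Q l h).
Proof.
have Esq a x y : E a x y = \sum_u E a u x * E a u y.
  rewrite -[E a in LHS](idem_bm a).2 mxE; apply: eq_bigr => u _.
  by congr (_ * _); rewrite EQ !mxE cC.
have : 0 <= \sum_x \sum_y E i x y * E j x y * E l x y.
  (* With E_a(x,y) = sum_u E_a(u,x) E_a(u,y) in each factor, the sums over x and y separate and
     leave a square for every triple u, v, w. *)
  rewrite (eq_bigr (fun x => \sum_u \sum_v \sum_w \sum_y
    (E i u x * E j v x * E l w x) * (E i u y * E j v y * E l w y))).
    rewrite exchange_big; apply: sumr_ge0 => u _.
    rewrite exchange_big; apply: sumr_ge0 => v _.
    rewrite exchange_big; apply: sumr_ge0 => w _.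
    under eq_bigr do rewrite -mulr_sumr.
    by rewrite -mulr_suml -expr2 sqr_ge0.
  move=> x _.
  under [RHS]eq_bigr do (under eq_bigr do rewrite exchange_big;
    rewrite exchange_big).
  rewrite exchange_big; apply: eq_bigr => y _.
  rewrite !(Esq _ x y) -mulrA mulr_suml; apply: eq_bigr => u _.
  rewrite mulr_suml mulr_sumr; apply: eq_bigr => v _.
  rewrite !mulr_sumr; apply: eq_bigr => w _.
  by ring.
rewrite (eq_bigr (fun=> n^-1 ^+ 3 * moment (fun h => Q i h * Q j h * Q l h))).
  rewrite sumr_const card_ord -[X in 0 <= X -> _]mulr_natl.
  by rewrite pmulr_rge0 ?n_gt0 // pmulr_rge0 // exprn_gt0 // invr_gt0 n_gt0.
move=> x _; rewrite -(sum_relation _ (enum_val x)) -sum_enum_val mulr_sumr.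
by apply: eq_bigr => y _; rewrite !EQ !mxE; ring.
Qed.

(** * Krein parameters *)

Variable q : 'I_D.+1 -> 'I_D.+1 -> 'I_D.+1 -> R.
Hypothesis qP : krein_parameters E q.

Lemma QM i j h : Q i h * Q j h = \sum_l q i j l * Q l h.
Proof.
have := qP i j; rewrite !EQ !bmZ bm_hadamard.
under eq_bigr do rewrite EQ bmZ.
rewrite bm_sumE bmZ => /bm_inj/(_ h) e.
have -> : Q i h * Q j h = n ^+ 2 * (n^-1 * Q i h * (n^-1 * Q j h)).
  by field; rewrite n_neq0.
rewrite e mulrA mulr_sumr; apply: eq_bigr => l _; field; exact: n_neq0.
Qed.

Lemma moment3E i j l :
  moment (fun h => Q i h * Q j h * Q l h) = q i j l * n * Q l ord0.
Proof.
rewrite (momentE (g := fun h => \sum_s q i j s * (Q s h * Q l h))); last first.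
  by move=> h; rewrite QM mulr_suml; apply: eq_bigr => s _; rewrite mulrA.
rewrite /moment; under eq_bigr do rewrite mulr_sumr.
rewrite exchange_big /= (bigD1 l) //= [X in _ + X]big1 => [|s sl].
  rewrite addr0; under eq_bigr do rewrite mulrCA.
  rewrite -mulr_sumr; have:= moment_orth l l; rewrite /moment => ->.
  by rewrite eqxx mul1r mulrA.
under eq_bigr do rewrite mulrCA.
rewrite -mulr_sumr; have:= moment_orth s l; rewrite /moment => ->.
by rewrite (negPf sl) !mul0r mulr0.
Qed.

Lemma Q_0 h : Q ord0 h = 1.
Proof.
have [x [y <-]] := cE h; have [E0 _ _] := EP.
have := EQ ord0; rewrite E0 => /matrixP/(_ (enum_rank x) (enum_rank y)).
rewrite !mxE !enum_rankK => /esym/(canRL (mulVKf n_neq0)) ->.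
by rewrite divff ?n_neq0.
Qed.

(** Summed over j, [moment3E] contains the factor sum_j Q_j, which is n at relation 0 and 0
    elsewhere. *)
Lemma q_row i l : \sum_j q i j l = Q i ord0.
Proof.
have nm : n * Q l ord0 != 0 by rewrite mulf_neq0 ?n_neq0 ?gt_eqF ?Q0_gt0.
apply: (mulIf nm); rewrite mulr_suml.
under eq_bigr do rewrite mulrA -moment3E.
rewrite exchange_big /= (eq_bigr (fun h =>
  (k h)%:R * (Q i h * Q l h * ((h == ord0)%:R * n)))) => [|h _].
  rewrite (bigD1 ord0) //= big1 => [|h h0].
    by rewrite valency0; ring.
  by rewrite (negPf h0) mul0r !mulr0.
by rewrite -sum_Q !mulr_sumr; apply: eq_bigr => j _; ring.
Qed.

Lemma q_col0 i l : q i ord0 l = (i == l)%:R.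
Proof.
have nm : n * Q l ord0 != 0 by rewrite mulf_neq0 ?n_neq0 ?gt_eqF ?Q0_gt0.
apply: (mulIf nm); rewrite mulrA -moment3E.
rewrite (momentE (g := fun h => Q i h * Q l h)) => [|h].
  by rewrite moment_orth; case: eqP => [->|_]; rewrite ?mul0r // mulrA.
by rewrite Q_0 mulr1.
Qed.

(** Up to the factor n, both sides are the symmetric triple moment of Q_i, Q_j and Q_l. *)
Lemma q_triangle i j l : q i j l * Q l ord0 = q i l j * Q j ord0.
Proof.
apply: (mulIf n_neq0); rewrite mulrAC -moment3E mulrAC -moment3E.
by apply: momentE => h; rewrite mulrAC.
Qed.

Lemma q_ge0 i j l : 0 <= q i j l.
Proof.
have nm : 0 < n * Q l ord0 by rewrite mulr_gt0 ?n_gt0 ?Q0_gt0.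
by rewrite -(pmulr_lge0 _ nm) mulrA -moment3E moment3_ge0.
Qed.

Lemma moment_lin a f g :
  moment (fun h => a * f h + g h) = a * moment f + moment g.
Proof.
by rewrite /moment mulr_sumr -big_split; apply: eq_bigr => h _ /=; ring.
Qed.

Lemma moment_p1 i i' :
  moment (fun h => (p h i i')%:R) = (k i)%:R * (k i')%:R.
Proof.
have := moment_p i i' ord0; rewrite !Q_0 !mulr1 => <-.
by apply: momentE => h; rewrite Q_0 mulr1.
Qed.

(** * Multiplicative sign functions on pairs *)

Variable eps : 'I_D.+1 -> R.
Hypotheses (eps0 : eps ord0 = 1)
  (epsM : forall x y z, eps (c x z) * eps (c z y) = eps (c x y)).

Lemma switching_sqr h : eps h * eps h = 1.
Proof.
by have [x [y <-]] := cE h; rewrite {2}cC epsM; have /eqP -> : c x x == ord0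
  by rewrite c0.
Qed.

Lemma moment1 : moment (fun=> 1) = n.
Proof.
by have [x _] := cE ord0; rewrite -(sum_relation _ x) sumr_const.
Qed.

(** Since eps(x,z) = eps(x,y) eps(y,z), the factor eps(x,y) leaves the sum over z. *)
Lemma bmM_switching f :
  bm eps *m bm f = moment (fun h => eps h * f h) *: bm eps.
Proof.
apply/matrixP => x y; rewrite !mxE; under eq_bigr do rewrite !mxE.
rewrite (sum_enum_val (fun z => eps (c (enum_val x) z) * f (c z (enum_val y)))).
rewrite -(sum_relation _ (enum_val y)) mulr_suml; apply: eq_bigr => z _.
by rewrite -(epsM _ z (enum_val y)) (cC z); ring.
Qed.

(** Some E_l is not annihilated by [bm eps], since the E_l sum to 1. There the product is a multiple
    both of E_l and of [bm eps], so Q_l is proportional to [eps]. *)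
Lemma switching_idempotent : exists l, Q l =1 eps.
Proof.
have eps_neq0 : bm eps != 0.
  apply/eqP => /matrixP; have [x _] := cE ord0.
  move/(_ (enum_rank x) (enum_rank x)); rewrite bm_diag eps0 mxE.
  by move/eqP; rewrite oner_eq0.
have [l ml] : exists l, moment (fun h => eps h * Q l h) != 0.
  apply/existsP; apply: contraT; rewrite negb_exists => /forallP m0.
  case/eqP: eps_neq0; rewrite -[bm eps]mulmx1 -sum_idem mulmx_sumr.
  rewrite big1 // => l _.
  by rewrite bmM_idem (eqP (negbNE (m0 l))) mul0r scale0r.
have Qe h : Q l h = Q l ord0 * eps h.
  have e := bmM_idem eps l; rewrite EQ -scalemxAr bmM_switching !bmZ in e.
  have Ql := lt0r_neq0 (Q0_gt0 l); have n0 := n_neq0.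
  apply: (mulfI ml); have := bm_inj e h => /= {}e.
  have -> : moment (fun h => eps h * Q l h) * Q l h = n * Q l ord0 *
    (moment (fun h => eps h * Q l h) / Q l ord0 * (n^-1 * Q l h)).
    by field; rewrite n0.
  by rewrite -e; field.
(* As eps^2 = 1, the squared norm of Q_l is n Q_l(0)^2, while orthogonality makes it n Q_l(0). *)
exists l => h; rewrite Qe; suff -> : Q l ord0 = 1 by rewrite mul1r.
have nm := mulf_neq0 n_neq0 (lt0r_neq0 (Q0_gt0 l)).
apply: (mulIf nm); rewrite mul1r; have := moment_orth l l.
rewrite eqxx mul1r => e; rewrite -[RHS]e.
rewrite (momentE (g := fun h => Q l ord0 ^+ 2 * 1 + 0)) => [|i].
  rewrite moment_lin moment1 /moment big1 => [|i _]; last by rewrite mulr0.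
  by rewrite addr0; ring.
by rewrite (Qe i) mulrACA switching_sqr expr2 addr0.
Qed.

(* Entrywise multiplication by a multiplicative function on pairs is an
   algebra automorphism, so it maps E_i to an idempotent. *)
Lemma switching_krein i l h : Q l =1 eps -> q i l h = 0 \/ q i l h = 1.
Proof.
move=> le; pose Y := n^-1 *: bm (fun t => Q i t * Q l t).
have YE : Y = \sum_t q i l t *: E t.
  rewrite /Y; under eq_bigr do rewrite EQ bmZ.
  rewrite bm_sumE bmZ; apply/matrixP => x y; rewrite !mxE QM mulr_sumr.
  by apply: eq_bigr => t _; ring.
have YY : Y *m Y = Y.
  have Ei u v : E i u v = n^-1 * Q i (c (enum_val u) (enum_val v)).
    by rewrite EQ !mxE.
  apply/matrixP => x y; have /matrixP/(_ x y) := (idem_bm i).2.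
  rewrite !mxE Ei mulrA => <-; rewrite mulr_suml; apply: eq_bigr => z _.
  rewrite !Ei !mxE !le -(epsM (enum_val x) (enum_val y) (enum_val z)).
  by ring.
(* The Krein parameter is the eigenvalue on E_h of the idempotent Y. *)
have Yh : Y *m E h = q i l h *: E h.
  rewrite YE mulmx_suml (bigD1 h) //= big1 => [|t th].
    by rewrite -scalemxAl idem_orth eqxx scale1r addr0.
  by rewrite -scalemxAl idem_orth (negPf th) scale0r scaler0.
have := mulmxA Y Y (E h); rewrite YY Yh -scalemxAr Yh scalerA => /eqP.
rewrite -subr_eq0 -scalerBl scaler_eq0 (negPf (idem_neq0 h)) orbF.
rewrite -{3}[q i l h]mulr1 -mulrBr mulf_eq0 subr_eq0.
by case/orP=> /eqP; [left|right].
Qed.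

End BoseMesner.

(** * Dual eigenvalues and the Krein array *)

(** Clears the denominators of the tightness equation; m - 1 - a stands for b_1, by the row sum of
    the Krein parameters. *)
Lemma dual_tight_eqE (F : fieldType) (m a x z : F) : a + 1 != 0 ->
  ((x + m / (a + 1)) * (z + m / (a + 1)) =
    - (m * a * (m - 1 - a)) / (a + 1) ^+ 2) <->
  m * (x + z) + (a + 1) * (x * z) + m * (m - a) = 0.
Proof.
move=> a1.
have -> : m * (x + z) + (a + 1) * (x * z) + m * (m - a) =
  (a + 1) * ((x + m / (a + 1)) * (z + m / (a + 1)) -
    - (m * a * (m - 1 - a)) / (a + 1) ^+ 2) by field.
split=> [->|/eqP]; first by rewrite subrr mulr0.
by rewrite mulf_eq0 (negPf a1) /= subr_eq0 => /eqP.
Qed.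

(** Successive divided differences of the quartic vanish at its distinct roots: the third gives the
    cubic coefficient, and back-substitution the constant term. *)
Lemma Vieta4 (F : idomainType) (al be ga de x y z t : F) :
  (forall s, s \in [:: x; y; z; t] ->
     s ^+ 4 + al * s ^+ 3 + be * s ^+ 2 + ga * s + de = 0) ->
  uniq [:: x; y; z; t] ->
  al = - (x + y + z + t) /\ de = x * y * z * t.
Proof.
move=> rts; rewrite /= !inE !negb_or.
case/and4P=> /and3P[xy xz xt] /andP[yz yt] zt _.
have fx := rts x; have fy := rts y; have fz := rts z; have ft := rts t.
rewrite !inE !eqxx ?orbT in fx fy fz ft.
move: (fx isT) (fy isT) (fz isT) (ft isT) => {}fx {}fy {}fz {}ft {rts}.
have cancel2 (u v w : F) : u != v -> (u - v) * w = 0 -> w = 0.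
  move=> uv /eqP; rewrite mulf_eq0 subr_eq0 (negPf uv) => /= /eqP //.
(* First divided difference of the quartic. *)
pose g u v := (u ^+ 3 + u ^+ 2 * v + u * v ^+ 2 + v ^+ 3)
   + al * (u ^+ 2 + u * v + v ^+ 2) + be * (u + v) + ga.
have gP u v : u != v -> u ^+ 4 + al * u ^+ 3 + be * u ^+ 2 + ga * u + de = 0 ->
   v ^+ 4 + al * v ^+ 3 + be * v ^+ 2 + ga * v + de = 0 -> g u v = 0.
  move=> uv fu fv; apply: (cancel2 u v) => //; rewrite /g.
  transitivity ((u ^+ 4 + al * u ^+ 3 + be * u ^+ 2 + ga * u + de) -
   (v ^+ 4 + al * v ^+ 3 + be * v ^+ 2 + ga * v + de)); first by ring.
  by rewrite fu fv subrr.
have gxy := gP _ _ xy fx fy; have gxz := gP _ _ xz fx fz.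
have gxt := gP _ _ xt fx ft.
(* Second divided difference, at x, v and w. *)
pose h v w := (x ^+ 2 + v ^+ 2 + w ^+ 2 + x * v + x * w + v * w)
  + al * (x + v + w) + be.
have hP v w : v != w -> g x v = 0 -> g x w = 0 -> h v w = 0.
  move=> vw gv gw; apply: (cancel2 v w) => //; rewrite /h.
  by transitivity (g x v - g x w); [rewrite /g; ring|rewrite gv gw subrr].
have hyz := hP _ _ yz gxy gxz; have hyt := hP _ _ yt gxy gxt.
have alE : al = - (x + y + z + t).
  apply/eqP; rewrite -subr_eq0 opprK; apply/eqP.
  apply: (cancel2 z t) => //.
  by transitivity (h y z - h y t); [rewrite /h; ring|rewrite hyz hyt subrr].
split=> //.
have beE : be = - (x ^+ 2 + y ^+ 2 + z ^+ 2 + x * y + x * z + y * z)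
  - al * (x + y + z).
  by apply/eqP; rewrite -subr_eq0 -hyz /h; apply/eqP; ring.
have gaE : ga = - (x ^+ 3 + x ^+ 2 * y + x * y ^+ 2 + y ^+ 3)
   - al * (x ^+ 2 + x * y + y ^+ 2) - be * (x + y).
  by apply/eqP; rewrite -subr_eq0 -gxy /g; apply/eqP; ring.
have -> : de = - (x ^+ 4 + al * x ^+ 3 + be * x ^+ 2 + ga * x).
  by apply/eqP; rewrite -subr_eq0 -fx; apply/eqP; ring.
by rewrite gaE beE alE; ring.
Qed.

(** * The recurrence linking Q_1, Q_2 and Q_3 *)

Section KreinArray.

Variables (R : rcfType) (m a a2 a3 b1 b2 c2 c3 : R).

(* x, u and w stand for the values of Q_1, Q_2 and Q_3 at one relation. *)
Definition qrec (x u w : R) : Prop :=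
  [/\ x ^+ 2 = m + a * x + c2 * u,
      x * u = b1 * x + a2 * u + c3 * w
    & x * w = b2 * u + a3 * w].

Hypotheses (m0 : m != 0) (b1_0 : b1 != 0) (b2_0 : b2 != 0).
Hypotheses (row1 : 1 + a + b1 = m) (row2 : c2 + a2 + b2 = m)
  (row3 : c3 + a3 = m).

Variables (u0 w0 : R).
Hypotheses (rec0 : qrec m u0 w0) (w0_0 : w0 != 0).

Let c3w0 : c3 * w0 = b2 * u0.
Proof. by case: rec0 => _ _ e; rewrite -row3 in e; lra. Qed.

(* With x = theta^*_1 and z = theta^*_3 (or conversely), this excludes
   A_1 A_3 = k_3 A_1 and A_1 A_3 = k_1 A_3, since theta^*_0 = m. *)
Lemma no_absorption x u w z v t :
  qrec x u w -> qrec z v t ->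
  x * z = m * x -> u * v = u0 * u -> w * t = w0 * w -> z = m.
Proof.
move=> [x1 x2 x3] [z1 z2 z3] xz uv wt.
have cancel (s y y0 : R) : s != 0 -> s * y = y0 * s -> y = y0.
  by move=> s0; rewrite mulrC => /(mulIf s0).
have [x0|/cancel] := eqVneq x 0; last by apply.
(* If x = 0, then u and w are nonzero by the recurrence, so v and t equal u0 and w0, and the third
   equations at z and at m give z = m. *)
have u_0 : u != 0.
  by apply: contraNneq m0 => u0'; apply/eqP; move: x1; rewrite x0 u0'; lra.
have w_0 : w != 0.
  apply: contraNneq (mulf_neq0 b2_0 u_0) => w0'; apply/eqP.
  by rewrite x0 w0' !mul0r mulr0 addr0 in x3.
have vE := cancel _ _ _ u_0 uv; have tE := cancel _ _ _ w_0 wt.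
apply: (mulIf w0_0); rewrite -{1}tE z3 vE tE; case: rec0 => _ _ ->.
by [].
Qed.

(** The third equation reads (s - a3) Q_3 = b2 Q_2. Multiplying its instances at x and z and
    comparing with y gives (x - a3)(z - a3) = c3 (y - a3), which with x z = m y amounts to a3 (m -
    x)(m - z) = 0. *)
Lemma tight_rec_a3_eq0 x u w y v t z u' w' :
  qrec x u w -> qrec y v t -> qrec z u' w' ->
  x * z = m * y -> u * u' = u0 * v -> w * w' = w0 * t ->
  x != m -> z != m -> a3 = 0.
Proof.
move=> [x1 x2 x3] [y1 y2 y3] [z1 z2 z3] xz uu ww xm zm.
(* A zero [t] would propagate down the recurrence to v = 0, y = 0 and finally m = 0. *)
have [t0|t0] := eqVneq t 0.
  have v0 : v = 0.
    apply/eqP; move/eqP: y3; rewrite t0 !mulr0 addr0 eq_sym mulf_eq0.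
    by rewrite (negPf b2_0).
  have y0 : y = 0.
    apply/eqP; move/eqP: y2; rewrite t0 v0 !mulr0 !addr0 eq_sym mulf_eq0.
    by rewrite (negPf b1_0).
  by move: y1; rewrite y0 v0 => e; case/eqP: m0; lra.
have e : (x - a3) * (z - a3) = c3 * (y - a3).
  apply: (mulIf t0); apply: (mulIf w0_0).
  have -> : (x - a3) * (z - a3) * t * w0 = ((x - a3) * w) * ((z - a3) * w').
    by rewrite mulrACA ww; ring.
  have -> : (x - a3) * w = b2 * u by lra.
  have -> : (z - a3) * w' = b2 * u' by lra.
  rewrite mulrACA uu.
  have -> : c3 * (y - a3) * t * w0 = (c3 * w0) * ((y - a3) * t) by ring.
  have -> : (y - a3) * t = b2 * v by lra.
  by rewrite c3w0; ring.
have : a3 * ((m - x) * (m - z)) = 0.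
  have -> : a3 * ((m - x) * (m - z)) =
    a3 * m * (m - x - z) + a3 * (x * z) by ring.
  have -> : a3 * m * (m - x - z) =
    m * ((x - a3) * (z - a3) - x * z - a3 ^+ 2 + a3 * m) by ring.
  by rewrite e xz -row3; ring.
move/eqP; rewrite !mulf_eq0 !subr_eq0 ![m == _]eq_sym (negPf xm) (negPf zm).
by rewrite !orbF => /eqP.
Qed.

(* Once a_3^* = 0, eliminating Q_2 and Q_3 from the recurrence leaves a monic
   quartic whose roots are the four dual eigenvalues. *)
Lemma tight_rec_array x u w y v t z u' w' :
  a3 = 0 -> qrec x u w -> qrec y v t -> qrec z u' w' ->
  uniq [:: m; x; y; z] -> x * z = m * y ->
  m * (x + z) + (a + 1) * (x * z) + m * (m - a) = 0 ->
  b2 = y ^+ 2 /\ a2 = - (a * y).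
Proof.
move=> a30 rx ry rz un xz tgt.
have c3m : c3 = m by rewrite -row3 a30 addr0.
have quartic s p q : qrec s p q ->
    s ^+ 4 + - (a + a2) * s ^+ 3 + (a * a2 - m - b2 * m - b1 * c2) * s ^+ 2 +
    (a2 * m + a * b2 * m) * s + b2 * m ^+ 2 = 0.
  case=> s1 s2 s3; rewrite a30 mul0r addr0 in s3.
  have -> : s ^+ 4 + - (a + a2) * s ^+ 3 +
    (a * a2 - m - b2 * m - b1 * c2) * s ^+ 2 +
    (a2 * m + a * b2 * m) * s + b2 * m ^+ 2 =
    (s ^+ 2 - a2 * s - b2 * m) * (s ^+ 2 - a * s - m) - b1 * c2 * s ^+ 2.
    by ring.
  have -> : s ^+ 2 - a * s - m = c2 * p by rewrite s1; ring.
  have e : m * (b2 * p) = s * (s * p - b1 * s - a2 * p).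
    by rewrite -s3 s2 c3m; ring.
  have -> : (s ^+ 2 - a2 * s - b2 * m) * (c2 * p) - b1 * c2 * s ^+ 2 =
    c2 * (s * (s * p - b1 * s - a2 * p) - m * (b2 * p)) by ring.
  by rewrite e subrr mulr0.
have rts s : s \in [:: m; x; y; z] -> s ^+ 4 + - (a + a2) * s ^+ 3 +
    (a * a2 - m - b2 * m - b1 * c2) * s ^+ 2 +
    (a2 * m + a * b2 * m) * s + b2 * m ^+ 2 = 0.
  by rewrite !inE => /or4P[] /eqP->; [apply: quartic rec0|
    apply: quartic rx|apply: quartic ry|apply: quartic rz].
(* Vieta gives a + a2 = m + x + y + z and b2 m^2 = m x y z. The latter becomes b2 = y^2 through x z
   = m y; the tightness equation supplies x + z for the former. *)
have [e1 e2] := Vieta4 rts un.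
have sE : x + z = a - m - (a + 1) * y.
  apply: (mulfI m0); rewrite xz in tgt; apply/eqP.
  by rewrite -subr_eq0 -tgt; apply/eqP; ring.
split; last by have -> : a2 = m + y + (x + z) - a by [lra]; rewrite sE; ring.
apply: (mulIf m0); apply: (mulIf m0).
have -> : b2 * m * m = m * y * (x * z) by rewrite -mulrA -expr2 e2; ring.
by rewrite xz; ring.
Qed.

(** With b2 = y^2 and a2 = - a y, the two final inequalities read y <= -1 and y^2 <= - y, so y = -1.
    Then b2 = 1, a2 = a and c2 = b1, and the recurrence yields the signs. *)
Lemma tight_rec_values x u w y v t z u' w' :
  a3 = 0 -> qrec x u w -> qrec y v t -> qrec z u' w' ->
  uniq [:: m; x; y; z] -> x * z = m * y ->
  m * (x + z) + (a + 1) * (x * z) + m * (m - a) = 0 ->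
  0 <= a -> (a = 0 -> a2 = 0 -> False) ->
  0 <= a2 - a -> 0 <= a2 - a * b2 ->
  [/\ a != 0, y = -1, w0 = 1, t = 1 & w = -1 /\ w' = -1].
Proof.
move=> a30 rx ry rz un xz tgt age0 nbip K1 K2.
have [b2E a2E] := tight_rec_array a30 rx ry rz un xz tgt.
have a_0 : a != 0.
  by apply/eqP => az; apply: nbip => //; rewrite a2E az mul0r oppr0.
have a_gt0 : 0 < a by rewrite lt_def a_0.
have yE : y = -1.
  have y1 : y <= -1.
    by rewrite -(ler_pM2l a_gt0); lra.
  have y2 : 0 <= - y - y ^+ 2.
    by rewrite -(pmulr_rge0 _ a_gt0); rewrite a2E b2E in K2; lra.
  nra.
have b21 : b2 = 1 by rewrite b2E yE; ring.
have a2a : a2 = a by rewrite a2E yE; ring.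
have c2b1 : c2 = b1 by move: row1 row2; rewrite a2a b21; lra.
have sE : x + z = 2 * a + 1 - m.
  by apply: (mulfI m0); rewrite xz yE in tgt; lra.
have xz' : x * z = - m by rewrite xz yE; ring.
(* Both x and z satisfy s^2 = (2 a + 1 - m) s + m, so the recurrence gives Q_2 = - s and then Q_3 =
   -1 there. *)
have val s s' p q : s * s' = - m -> s + s' = 2 * a + 1 - m ->
    qrec s p q -> q = -1.
  move=> ss ds [s1 s2 s3].
  have s_0 : s != 0.
    by apply: contraNneq m0 => s0; rewrite s0 mul0r in ss; apply/eqP; lra.
  have pE : p = - s.
    apply: (mulfI b1_0); rewrite c2b1 in s1.
    have e : s ^+ 2 = s * (s + s') - s * s' by ring.
    rewrite ds ss in e.
    have -> : b1 * p = s ^+ 2 - m - a * s by rewrite s1; ring.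
    by rewrite e -row1; ring.
  by apply: (mulfI s_0); rewrite s3 pE b21 a30; ring.
have u0E : u0 = m.
  case: rec0 => m1 _ _; apply: (mulfI b1_0); rewrite c2b1 in m1.
  have -> : b1 * u0 = m ^+ 2 - m - a * m by rewrite m1; ring.
  by rewrite -row1; ring.
split=> //.
- apply: (mulfI m0); have := c3w0; rewrite b21 u0E -row3 a30 addr0 => ->; ring.
- case: ry => y1 _ y3.
  have vE : v = -1.
    apply: (mulfI b1_0); move: y1; rewrite yE c2b1 => y1.
    have -> : b1 * v = (-1) ^+ 2 - m - a * -1 by rewrite y1; ring.
    by rewrite -row1; ring.
  by move: y3; rewrite yE vE b21 a30; lra.
split; first exact: val xz' sE rx.
by rewrite mulrC in xz'; rewrite addrC in sE; exact: val xz' sE rz.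
Qed.

End KreinArray.

(** Meant for N_h = k_h p^h_{13}. The recurrence reduces the sum of squares to the three known sums,
    and b1 times it equals K (m - x)(m - z) times the left side of the tightness equation. *)
Lemma tight_sum_sqr_eq0 (R : rcfType) (I : finType) (N X U : I -> R)
    (m a b1 c2 u0 x z u u' K : R) :
  m != 0 -> b1 != 0 -> u0 != 0 -> 1 + a + b1 = m -> c2 * u0 = b1 * m ->
  x ^+ 2 = m + a * x + c2 * u -> z ^+ 2 = m + a * z + c2 * u' ->
  (forall i, X i ^+ 2 = m + a * X i + c2 * U i) ->
  \sum_i N i = K -> (\sum_i N i * X i) * m = K * (x * z) ->
  (\sum_i N i * U i) * u0 = K * (u * u') ->
  m * (x + z) + (a + 1) * (x * z) + m * (m - a) = 0 ->
  \sum_i N i * (m * X i - x * z) ^+ 2 = 0.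
Proof.
move=> m0 b10 u00 row1 cu hx hz hX S0 S1 S2 tgt.
have -> : \sum_i N i * (m * X i - x * z) ^+ 2 =
    (m ^+ 3 + (x * z) ^+ 2) * K +
    (m * a - 2 * (x * z)) * ((\sum_i N i * X i) * m) +
    m ^+ 2 * c2 * (\sum_i N i * U i).
  rewrite -S0 !mulr_suml !mulr_sumr -!big_split /=; apply: eq_bigr => i _.
  have -> : N i * (m * X i - x * z) ^+ 2 = N i * (m ^+ 2 * X i ^+ 2 -
    2 * m * (x * z) * X i + (x * z) ^+ 2) by ring.
  by rewrite hX; ring.
rewrite S1; apply: (mulIf u00); apply: (mulIf b10); rewrite mul0r mul0r.
have -> : ((m ^+ 3 + (x * z) ^+ 2) * K + (m * a - 2 * (x * z)) * (K * (x * z)) +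
   m ^+ 2 * c2 * (\sum_i N i * U i)) * u0 * b1 =
  K * (b1 * u0 * (m ^+ 3 + m * a * (x * z) - (x * z) ^+ 2)) +
   m ^+ 2 * c2 * b1 * ((\sum_i N i * U i) * u0) by ring.
rewrite S2.
have -> : m ^+ 2 * c2 * b1 * (K * (u * u')) =
   K * (m * (b1 * m) * (c2 * (u * u'))) by ring.
rewrite -cu.
have -> : m * (c2 * u0) * (c2 * (u * u')) = m * u0 * ((c2 * u) * (c2 * u'))
  by ring.
have -> : c2 * u = x ^+ 2 - a * x - m by rewrite hx; ring.
have -> : c2 * u' = z ^+ 2 - a * z - m by rewrite hz; ring.
have -> : K * (b1 * u0 * (m ^+ 3 + m * a * (x * z) - (x * z) ^+ 2)) +
   K * (m * u0 * ((x ^+ 2 - a * x - m) * (z ^+ 2 - a * z - m))) =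
  K * u0 * (b1 * (m ^+ 3 + m * a * (x * z) - (x * z) ^+ 2) +
   m * ((x ^+ 2 - a * x - m) * (z ^+ 2 - a * z - m))) by ring.
have -> : b1 = m - 1 - a by rewrite -row1; ring.
have -> : (m - 1 - a) * (m ^+ 3 + m * a * (x * z) - (x * z) ^+ 2) +
   m * ((x ^+ 2 - a * x - m) * (z ^+ 2 - a * z - m)) =
  (m * (x + z) + (a + 1) * (x * z) + m * (m - a)) *
  (x * z - m * (x + z) + m * m) by ring.
by rewrite tgt mul0r mulr0.
Qed.

(** * Schemes of class 3 *)

Local Notation i1 := (inord 1 : 'I_4).
Local Notation i2 := (inord 2 : 'I_4).
Local Notation i3 := (inord 3 : 'I_4).

Lemma ord4P (P : 'I_4 -> Prop) :
  P ord0 -> P i1 -> P i2 -> P i3 -> forall h, P h.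
Proof.
move=> P0 P1 P2 P3 [[|[|[|[|//]]]] lt]; [move: P0|move: P1|move: P2|move: P3];
  by congr P; apply: val_inj; rewrite /= ?inordK.
Qed.

Lemma sum_ord4 (V : nmodType) (F : 'I_4 -> V) :
  \sum_h F h = F ord0 + F i1 + F i2 + F i3.
Proof.
rewrite !big_ord_recl big_ord0 addr0 !addrA.
by do 3?[congr (_ + _)]; congr F; apply: val_inj; rewrite /= ?inordK.
Qed.

Lemma cover4 (a b c d h : 'I_4) : uniq [:: a; b; c; d] ->
  h \in [:: a; b; c; d].
Proof.
move=> un; have /subset_cardP : #|[:: a; b; c; d]| = #|'I_4|.
  by rewrite (card_uniqP un) card_ord.
by move=> /(_ (subset_predT _)) ->.
Qed.

(** The two values other than -1 have sum s and product - m. Were -1 the largest, both would be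
    negative; were it the smallest, 0 < x < m and y > -1 would give x y > - m. *)
Lemma middle_root (R : rcfType) (m s x y z : R) : 0 < m ->
  x < m -> y < x -> z < y -> -1 \in [:: x; y; z] ->
  x + y + z = -1 + s -> x ^+ 2 + y ^+ 2 + z ^+ 2 = 1 + s ^+ 2 + 2 * m ->
  x + z = s /\ x * z = - m.
Proof.
move=> m0 xm yx zy; rewrite !inE => /or3P[] /eqP y1 e1 e2.
- have yz : y * z = - m.
    have : (y + z) ^+ 2 = y ^+ 2 + z ^+ 2 + 2 * (y * z) by ring.
    by have -> : y + z = s by [lra]; rewrite -y1 in e2; lra.
  have : 0 < (-1 - y) * (-1 - z) by apply: mulr_gt0; lra.
  have -> : (-1 - y) * (-1 - z) = 1 + y + z + y * z by ring.
  by rewrite yz; lra.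
- have e : x + z = s by lra.
  split=> //; have : (x + z) ^+ 2 = x ^+ 2 + z ^+ 2 + 2 * (x * z) by ring.
  by rewrite e; rewrite -y1 in e2; lra.
- have xy : x * y = - m.
    have : (x + y) ^+ 2 = x ^+ 2 + y ^+ 2 + 2 * (x * y) by ring.
    by have -> : x + y = s by [lra]; rewrite -y1 in e2; lra.
  have x0 : 0 < x by nra.
  have : 0 < x * (y + 1) by apply: mulr_gt0 => //; lra.
  by rewrite mulrDr xy; lra.
Qed.

Lemma split_proportion (R : rcfType) (m x y : R) : 0 < m ->
  x + y = 1 + m -> x = y * m -> x = m /\ y = 1.
Proof.
move=> m0 e xy; have y1 : y = 1.
  have m1 : 1 + m != 0 by rewrite gt_eqF // addr_gt0.
  by apply: (mulIf m1); rewrite mul1r -[RHS]e xy; ring.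
by rewrite xy y1 mul1r.
Qed.

Section Class3.

Variables (R : rcfType) (X : finType) (r : 'I_4 -> rel X).
Variables (c : X -> X -> 'I_4) (p : 'I_4 -> 'I_4 -> 'I_4 -> nat).
Hypotheses (rc : forall i x y, r i x y = (c x y == i))
  (c0 : forall x y, (c x y == ord0) = (x == y))
  (cC : forall x y, c x y = c y x)
  (cE : forall i, exists x y, c x y = i)
  (cp : forall i j x y,
     #|[set z | (c x z == i) && (c z y == j)]| = p (c x y) i j).
Variables (E : 'I_4 -> 'M[R]_#|X|) (Q : 'I_4 -> 'I_4 -> R)
  (q : 'I_4 -> 'I_4 -> 'I_4 -> R) (theta : 'I_4 -> R).
Hypotheses (EP : primitive_idempotents r E)
  (EQ : forall j, E j = #|X|%:R^-1 *: bm c (Q j))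
  (qP : krein_parameters E q) (thetaP : dual_eigenvalues r E theta)
  (qpoly : q_polynomial q) (theta_dec : dual_eigenvalues_decreasing theta).

Local Notation n := (#|X|%:R : R).
Local Notation k := (valency p).
Local Notation m := (Q i1 ord0).
Local Notation a := (q i1 i1 i1).
Local Notation a2 := (q i1 i2 i2).
Local Notation a3 := (q i1 i3 i3).
Local Notation b1 := (q i1 i2 i1).
Local Notation b2 := (q i1 i3 i2).
Local Notation c2 := (q i1 i1 i2).
Local Notation c3 := (q i1 i2 i3).
(** The tightness equation, cleared of denominators, is [G = 0]. *)
Local Notation G := (m * (theta i1 + theta i3) +
  (a + 1) * (theta i1 * theta i3) + m * (m - a)).

(** * The Krein array of a class 3 scheme *)

Lemma theta_Q : theta =1 Q i1.
Proof.
move=> h; have := thetaP; rewrite /dual_eigenvalues EQ -(bmE_adj rc) !bmZ.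
move=> /(bm_inj cE)/(_ h)/esym; apply: mulfI.
by rewrite invr_eq0 (n_neq0 R cE).
Qed.

Lemma q_tridiagonal :
  [/\ q i1 ord0 i2 = 0, q i1 ord0 i3 = 0, q i1 i1 i3 = 0, q i1 i2 ord0 = 0 &
      q i1 i3 ord0 = 0 /\ q i1 i3 i1 = 0].
Proof.
by repeat split; apply: (qpoly _ _).1; rewrite !inordK.
Qed.

Lemma q_off_diagonal : [/\ b1 != 0, b2 != 0, c2 != 0 & c3 != 0].
Proof.
by split; apply/eqP; apply: (qpoly _ _).2; rewrite !inordK.
Qed.

Let m_gt0 : 0 < m. Proof. exact (Q0_gt0 rc c0 cC cE cp EP EQ i1). Qed.
Let u_gt0 : 0 < Q i2 ord0. Proof. exact (Q0_gt0 rc c0 cC cE cp EP EQ i2). Qed.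
Let w_gt0 : 0 < Q i3 ord0. Proof. exact (Q0_gt0 rc c0 cC cE cp EP EQ i3). Qed.
Let nn0 : n != 0. Proof. exact (n_neq0 R cE). Qed.
Let ngt0 : 0 < n. Proof. exact (n_gt0 R cE). Qed.
Let qc0 := q_col0 rc c0 cC cE cp EP EQ qP.
Let orth := moment_orth rc c0 cC cE cp EP EQ.

Let ne01 : ord0 != i1 :> 'I_4. Proof. by rewrite -val_eqE /= inordK. Qed.
Let ne02 : ord0 != i2 :> 'I_4. Proof. by rewrite -val_eqE /= inordK. Qed.
Let ne03 : ord0 != i3 :> 'I_4. Proof. by rewrite -val_eqE /= inordK. Qed.
Let ne12 : i1 != i2 :> 'I_4. Proof. by rewrite -val_eqE /= !inordK. Qed.
Let ne13 : i1 != i3 :> 'I_4. Proof. by rewrite -val_eqE /= !inordK. Qed.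
Let ne23 : i2 != i3 :> 'I_4. Proof. by rewrite -val_eqE /= !inordK. Qed.

Lemma krein_m : q i1 i1 ord0 = m.
Proof.
have := q_triangle rc c0 cC cE cp EP EQ qP i1 i1 ord0.
by rewrite qc0 eqxx mul1r (Q_0 cE EP EQ) mulr1.
Qed.

Lemma krein_rows :
  [/\ 1 + a + b1 = m, c2 + a2 + b2 = m & c3 + a3 = m].
Proof.
have [q02 q03 q13 q20 [q30 q31]] := q_tridiagonal.
have row l := esym (q_row rc c0 cC cE cp EP EQ qP i1 l).
rewrite {1}(row i1) {1}(row i2) {1}(row i3) !sum_ord4 !qc0 eqxx.
by rewrite (negPf ne12) (negPf ne13) q13 q31 !add0r addr0.
Qed.

Lemma krein_rec h : qrec m a a2 a3 b1 b2 c2 c3 (Q i1 h) (Q i2 h) (Q i3 h).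
Proof.
have [q02 q03 q13 q20 [q30 q31]] := q_tridiagonal.
have QM' := QM cE EQ qP i1.
split; rewrite ?expr2 QM' sum_ord4 ?krein_m ?(Q_0 cE EP EQ) ?q02 ?q03 ?q13
  ?q20 ?q30 ?q31; ring.
Qed.

Lemma krein_a_ge0 : 0 <= a.
Proof. exact (q_ge0 rc c0 cC cE cp EP EQ qP _ _ _). Qed.

Lemma krein_c2u0 : c2 * Q i2 ord0 = b1 * m.
Proof. exact (q_triangle rc c0 cC cE cp EP EQ qP i1 i1 i2). Qed.

Lemma krein_c3w0 : c3 * Q i3 ord0 = b2 * Q i2 ord0.
Proof. exact (q_triangle rc c0 cC cE cp EP EQ qP i1 i2 i3). Qed.

Lemma dual_tightE : dual_tight q theta <-> ~ q_bipartite q /\ G = 0.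
Proof.
have [row1 _ _] := krein_rows.
have a1 : a + 1 != 0.
  by rewrite gt_eqF // ltr_wpDl ?krein_a_ge0.
have b1E : bstar q i1 = m - 1 - a.
  by rewrite /bstar inordK // -row1; ring.
have -> : dual_tight q theta <-> ~ q_bipartite q /\
    (theta i1 + m / (a + 1)) * (theta i3 + m / (a + 1)) =
    - (m * a * (m - 1 - a)) / (a + 1) ^+ 2.
  rewrite /dual_tight /astar /mult krein_m b1E.
  by have -> : ord_max = i3 by apply: val_inj; rewrite /= inordK.
by split=> -[h1 h2]; split=> //; apply/(dual_tight_eqE _ _ _ a1).
Qed.

Lemma q_bipartiteP : a = 0 -> a2 = 0 -> a3 = 0 -> q_bipartite q.
Proof.
by move=> h1 h2 h3; apply: ord4P => //; rewrite /astar qc0 eq_sym (negPf ne01).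
Qed.

Lemma theta_uniq : uniq [:: m; Q i1 i1; Q i1 i2; Q i1 i3].
Proof.
have d (i j : 'I_4) : (i < j)%N -> Q i1 i != Q i1 j.
  by move=> /theta_dec; rewrite !theta_Q => ij; rewrite gt_eqF.
by rewrite /= !inE !negb_or !d ?inordK.
Qed.

(** * From dual-tightness to a symmetric design *)

Lemma p13_0 : p ord0 i1 i3 = 0%N.
Proof.
have [x _] := cE ord0; have /eqP <- : c x x == ord0 by rewrite c0.
rewrite -cp; apply/eqP; rewrite cards_eq0; apply/eqP/setP => z.
rewrite !inE (cC z); case: eqP => //= ->; exact/negbTE.
Qed.

(* Here h is the relation such that A_1 A_3 is a multiple of A_h. *)
Lemma tight_absorption : G = 0 -> exists h, h != ord0 /\
  forall j, Q j i1 * Q j i3 = Q j ord0 * Q j h.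
Proof.
rewrite !theta_Q => g0.
have [[row1 _ _] [b10 b20 c20 c30]] := (krein_rows, q_off_diagonal).
have k_gt0 h : 0 < ((k h)%:R : R) by rewrite ltr0n (valency_gt0 c0 cC cE cp).
(* N_h vanishes exactly when A_h is absent from A_1 A_3. *)
pose N h : R := (k h)%:R * (p h i1 i3)%:R.
pose K : R := (k i1)%:R * (k i3)%:R.
have N_ge0 h : 0 <= N h by rewrite mulr_ge0 ?ler0n.
have SN : \sum_h N h = K := moment_p1 rc c0 cC cE cp EP EQ i1 i3.
have SNQ j : (\sum_h N h * Q j h) * Q j ord0 = K * (Q j i1 * Q j i3).
  rewrite -(moment_p rc c0 cC cE cp EP EQ i1 i3 j); congr (_ * _).
  by apply: eq_bigr => h _; rewrite mulrA.
have sq0 : \sum_h N h * (m * Q i1 h - Q i1 i1 * Q i1 i3) ^+ 2 = 0.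
  have [r1 _ _] := krein_rec i1; have [r3 _ _] := krein_rec i3.
  apply: (tight_sum_sqr_eq0 (U := Q i2) _ b10 _ row1 krein_c2u0 r1 r3 _ SN);
    rewrite ?gt_eqF // => h; by case: (krein_rec h).
(* The terms are nonnegative, so each vanishes: all A_h occurring in A_1 A_3 share one dual
   eigenvalue, and these are distinct. *)
have N0 h : N h != 0 -> m * Q i1 h = Q i1 i1 * Q i1 i3.
  move=> Nh; apply/eqP; rewrite -subr_eq0 -sqrf_eq0.
  have /eqP := sq0; rewrite psumr_eq0 => [/allP/(_ h)|i _]; last first.
    by rewrite mulr_ge0 ?sqr_ge0.
  by rewrite mem_index_enum mulf_eq0 (negPf Nh) => /(_ isT).
have [h Nh] : exists h, N h != 0.
  apply/existsP; apply: contraT; rewrite negb_exists => /forallP Nz.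
  have : K = 0 by rewrite -SN big1 // => h _; apply/eqP/negbNE/Nz.
  by move/eqP; rewrite mulf_eq0 !gt_eqF.
have Nuniq i : i != h -> N i = 0.
  move=> ih; apply/eqP; apply: contraNT ih => /N0; rewrite -(N0 h Nh).
  move/mulfI => /(_ (lt0r_neq0 m_gt0)) e; apply: contraT => ih.
  have : (i != h :> nat) by rewrite val_eqE.
  by rewrite neq_ltn => /orP[] /theta_dec; rewrite !theta_Q e ltxx.
exists h; split.
  by apply: contraNneq Nh => ->; rewrite /N p13_0 mulr0.
move=> j; have K0 : K != 0 by rewrite mulf_neq0 ?gt_eqF.
apply: (mulfI K0); rewrite -SNQ.
have -> : K = N h by rewrite -SN (bigD1 h) //= big1 ?addr0.
rewrite (bigD1 h) //= big1 => [|i /Nuniq->]; last by rewrite mul0r.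
by rewrite addr0; ring.
Qed.

Lemma moment_orth_comb i (f : 'I_4 -> R) s1 s2 s3 :
  (forall h, f h = s1 * Q i1 h + s2 * Q i2 h + s3 * Q i3 h) ->
  moment p (fun h => Q i h * f h) =
    n * (s1 * ((i == i1)%:R * m) + s2 * ((i == i2)%:R * Q i2 ord0) +
         s3 * ((i == i3)%:R * Q i3 ord0)).
Proof.
move=> fE.
have e j : moment p (fun h => Q i h * Q j h) = n * ((i == j)%:R * Q j ord0).
  by rewrite orth; case: eqP => [->|_]; rewrite ?mul1r // !mul0r mulr0.
rewrite (momentE p (g := fun h => s1 * (Q i h * Q i1 h) +
  (s2 * (Q i h * Q i2 h) + (s3 * (Q i h * Q i3 h) + 0)))) => [|h].
  have m0 : moment p (fun=> 0 : R) = 0.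
    by rewrite /moment big1 // => h _; rewrite mulr0.
  by rewrite !moment_lin !e m0; ring.
by rewrite fE; ring.
Qed.

(* These are the Krein conditions q_{22}^3 >= 0 and q_{33}^3 >= 0. *)
Lemma krein_a2 : a3 = 0 -> 0 <= a2 - a /\ 0 <= a2 - a * b2.
Proof.
move=> a30.
have [[_ _ row3] [b10 b20 c20 c30]] := (krein_rows, q_off_diagonal).
rewrite a30 addr0 in row3.
have c2_gt0 : 0 < c2.
  by rewrite lt_def c20 (q_ge0 rc c0 cC cE cp EP EQ qP).
have b2_gt0 : 0 < b2.
  by rewrite lt_def b20 (q_ge0 rc c0 cC cE cp EP EQ qP).
(* Repeated use of the recurrence expands c2 Q_2 Q_3; orthogonality then reads triple moments off
   the coefficients. *)
have c2QQ h : c2 * (Q i2 h * Q i3 h) = (b2 * b1) * Q i1 h +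
    (b2 * (a2 - a)) * Q i2 h + (b2 * m - m) * Q i3 h.
  have [e1 e2 e3] := krein_rec h; rewrite a30 mul0r addr0 in e3.
  have -> : c2 * (Q i2 h * Q i3 h) = (c2 * Q i2 h) * Q i3 h by ring.
  have -> : c2 * Q i2 h = Q i1 h ^+ 2 - m - a * Q i1 h by rewrite e1; ring.
  have -> : (Q i1 h ^+ 2 - m - a * Q i1 h) * Q i3 h =
    Q i1 h * (Q i1 h * Q i3 h) - m * Q i3 h - a * (Q i1 h * Q i3 h) by ring.
  rewrite e3 (mulrCA _ b2) e2 row3; ring.
have M223 : c2 * moment p (fun h => Q i2 h * Q i2 h * Q i3 h) =
    n * (b2 * (a2 - a) * Q i2 ord0).
  have := moment_orth_comb i2 c2QQ.
  rewrite eqxx [i2 == i1]eq_sym (negPf ne12) (negPf ne23) mul1r !mul0r !mulr0.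
  rewrite add0r addr0 => <-; rewrite /moment mulr_sumr.
  by apply: eq_bigr => h _; ring.
have M233 : c2 * moment p (fun h => Q i2 h * Q i3 h * Q i3 h) =
    n * ((b2 * m - m) * Q i3 ord0).
  have := moment_orth_comb i3 c2QQ.
  rewrite eqxx [i3 == i1]eq_sym [i3 == i2]eq_sym (negPf ne13) (negPf ne23).
  rewrite mul1r !mul0r !mulr0 !add0r => <-; rewrite /moment mulr_sumr.
  by apply: eq_bigr => h _; ring.
have M333 : c2 * m * moment p (fun h => Q i3 h * Q i3 h * Q i3 h) =
    n * (m * Q i3 ord0 * (a2 - a * b2)).
  have -> : m * Q i3 ord0 * (a2 - a * b2) = b2 * (b2 * (a2 - a) * Q i2 ord0) -
      a2 * ((b2 * m - m) * Q i3 ord0).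
    by have := krein_c3w0; rewrite row3 => e; rewrite e; ring: e.
  have distr (A B : R) : n * (b2 * A - a2 * B) = b2 * (n * A) - a2 * (n * B).
    by ring.
  rewrite distr -M223 -M233.
  (* The second equation replaces m Q_3 by Q_1 Q_2 - b1 Q_1 - a2 Q_2, and Q_1 Q_3 = b2 Q_2 brings
     the cube down to the earlier moments. *)
  have e : m * moment p (fun h => Q i3 h * Q i3 h * Q i3 h) =
      b2 * moment p (fun h => Q i2 h * Q i2 h * Q i3 h) -
      a2 * moment p (fun h => Q i2 h * Q i3 h * Q i3 h) -
      b1 * b2 * moment p (fun h => Q i2 h * Q i3 h).
    rewrite /moment !mulr_sumr -!sumrB; apply: eq_bigr => h _.
    have [_ e2 e3] := krein_rec h; rewrite a30 mul0r addr0 row3 in e2 e3.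
    have -> : m * ((k h)%:R * (Q i3 h * Q i3 h * Q i3 h)) =
      (k h)%:R * (m * Q i3 h) * Q i3 h * Q i3 h by ring.
    have -> : m * Q i3 h = Q i1 h * Q i2 h - b1 * Q i1 h - a2 * Q i2 h.
      by rewrite e2; ring.
    have -> : (k h)%:R * (Q i1 h * Q i2 h - b1 * Q i1 h - a2 * Q i2 h) *
      Q i3 h * Q i3 h = (k h)%:R * ((Q i2 h - b1) * (Q i1 h * Q i3 h)
        - a2 * Q i2 h * Q i3 h) * Q i3 h by ring.
    by rewrite e3; ring.
  by rewrite -mulrA e orth (negPf ne23) !mul0r; ring.
have m3 i j l : 0 <= moment p (fun h => Q i h * Q j h * Q l h).
  exact: (moment3_ge0 c0 cC cE cp EP EQ i j l).
split.
- rewrite -(pmulr_rge0 _ (mulr_gt0 (mulr_gt0 ngt0 b2_gt0) u_gt0)).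
  suff -> : n * b2 * Q i2 ord0 * (a2 - a) =
    c2 * moment p (fun h => Q i2 h * Q i2 h * Q i3 h) 
    by apply: mulr_ge0; [exact: ltW | exact: m3].
  by rewrite M223; ring.
- rewrite -(pmulr_rge0 _ (mulr_gt0 ngt0 (mulr_gt0 m_gt0 w_gt0))).
  suff -> : n * (m * Q i3 ord0) * (a2 - a * b2) =
    c2 * m * moment p (fun h => Q i3 h * Q i3 h * Q i3 h).
    by apply: mulr_ge0; [apply: mulr_ge0; exact: ltW | exact: m3].
  by rewrite M333; ring.
Qed.

Lemma tight_values : dual_tight q theta ->
  [/\ a != 0, Q i1 i2 = -1, Q i1 i1 * Q i1 i3 = - m,
      Q i1 i1 + Q i1 i3 = 2 * a + 1 - m &
      [/\ Q i3 ord0 = 1, Q i3 i1 = -1, Q i3 i2 = 1 & Q i3 i3 = -1]].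
Proof.
move=> /dual_tightE[nbip g0].
have [[row1 row2 row3] [b10 b20 c20 c30]] := (krein_rows, q_off_diagonal).
have m0 := lt0r_neq0 m_gt0; have u0 := lt0r_neq0 u_gt0.
have w0 := lt0r_neq0 w_gt0.
have [h [h0 hQ]] := tight_absorption g0.
rewrite !theta_Q in g0.
have := theta_uniq; rewrite /= !inE !negb_or.
case/and4P=> /and3P[m1 m2' m3] /andP[x12 x13] x23 _.
(* The candidates h = 1 and h = 3 would make theta_3, respectively theta_1, equal to m. *)
have hE : h = i2.
  move: h h0 hQ; apply: ord4P => [/eqP //|||] _ hQ //.
  - have e := no_absorption m0 b20 (krein_rec ord0) w0 (krein_rec i1)
      (krein_rec i3) (hQ i1) (hQ i2) (hQ i3).
    by rewrite e eqxx in m3.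
  - have hQ' j : Q j i3 * Q j i1 = Q j ord0 * Q j i3 by rewrite mulrC.
    have e := no_absorption m0 b20 (krein_rec ord0) w0 (krein_rec i3)
      (krein_rec i1) (hQ' i1) (hQ' i2) (hQ' i3).
    by rewrite e eqxx in m1.
rewrite {h h0}hE in hQ.
have a30 : a3 = 0.
  apply: (tight_rec_a3_eq0 m0 b10 b20 row3 (krein_rec ord0) w0 (krein_rec i1)
    (krein_rec i2) (krein_rec i3) (hQ i1) (hQ i2) (hQ i3)); by rewrite eq_sym.
have [K1 K2] := krein_a2 a30.
have [a_0 y1 w0E t1 [w1 w3]] := tight_rec_values m0 b10 row1 row2 row3
  (krein_rec ord0) a30 (krein_rec i1) (krein_rec i2) (krein_rec i3) theta_uniq
  (hQ i1) g0 krein_a_ge0 (fun az a2z => nbip (q_bipartiteP az a2z a30)) K1 K2.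
have xz : Q i1 i1 * Q i1 i3 = - m by rewrite hQ y1 mulrN1.
split=> //; apply: (mulfI m0); rewrite xz in g0; apply/eqP.
by rewrite -subr_eq0 -g0; apply/eqP; ring.
Qed.

(** Serves the non-degeneracy of the design. By orthogonality, k_1 = 1 would give theta_3^2 = 1
    against theta_3 < -1, and k_3 = 1 would give theta_1 = 1, hence a = 0. *)
Lemma tight_valencies : dual_tight q theta ->
  (1 < k i1)%N /\ (1 < k i3)%N.
Proof.
move=> /tight_values[a_0 y1 xz xs [w0 w1 w2 w3]].
have kp h : (0 < k h)%N := valency_gt0 c0 cC cE cp h.
have k01 : k ord0 = 1%N := valency0 c0 cC cE cp.
have o1 := orth ord0 i1; have o2 := orth ord0 i3; have o3 := orth i1 i3.
rewrite (negPf ne01) in o1; rewrite (negPf ne03) in o2.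
rewrite (negPf ne13) in o3.
rewrite /moment !sum_ord4 !(Q_0 cE EP EQ) k01 ?w0 ?w1 ?w2 ?w3 ?y1 !mul0r
  in o1 o2 o3.
have zy : Q i1 i3 < -1.
  by rewrite -y1 -!theta_Q; apply: theta_dec; rewrite !inordK.
have xy : -1 < Q i1 i1.
  by rewrite -y1 -!theta_Q; apply: theta_dec; rewrite !inordK.
set x := Q i1 i1 in xz xs o1 o3 xy; set z := Q i1 i3 in xz xs o1 o3 zy.
have e2 : (k i2)%:R = m :> R by lra.
have e1 : (k i1)%:R + (k i3)%:R = 1 + m :> R by lra.
have e3 : (k i1)%:R * x = - ((k i3)%:R * z) :> R by lra.
have m0 := lt0r_neq0 m_gt0.
split; rewrite ltn_neqAle kp andbT eq_sym; apply/eqP => k1.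
- rewrite k1 in e1 e3.
  have e4 : (k i3)%:R = m :> R by lra.
  have xE : x = - (m * z) by rewrite e4 in e3; lra.
  have : z ^+ 2 = 1.
    apply: (mulfI m0); move: xz; rewrite xE => xz.
    by apply/eqP; rewrite mulr1 -eqr_opp -xz; apply/eqP; ring.
  nra.
- rewrite k1 in e1 e3.
  have e4 : (k i1)%:R = m :> R by lra.
  have zE : z = - (m * x) by rewrite e4 in e3; lra.
  have x2 : (x - 1) * (x + 1) = 0.
    apply: (mulfI m0); move: xz; rewrite zE => xz.
    by apply/eqP; rewrite mulr0 -(subrr (- m)) -{2}xz; apply/eqP; ring.
  have x1 : x = 1.
    by move/eqP: x2; rewrite mulf_eq0 => /orP[]/eqP ?; lra.
  by case/eqP: a_0; move: xs; rewrite zE x1; lra.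
Qed.

(** Idempotence of E_3 makes a sum of n signs equal to n times a sign, so all its terms agree. *)
Lemma tight_switching : dual_tight q theta ->
  forall x y z, Q i3 (c x z) * Q i3 (c z y) = Q i3 (c x y).
Proof.
move=> /tight_values[_ _ _ _ [w0 w1 w2 w3]] x y z.
pose s x y := Q i3 (c x y).
have spm u v : s u v = 1 \/ s u v = -1.
  by rewrite /s; move: (c u v); apply: ord4P; rewrite ?w0 ?w1 ?w2 ?w3; auto.
have conv : \sum_z s x z * s z y = n * s x y.
  have := (idem_bm EP i3).2; rewrite EQ -scalemxAl -scalemxAr.
  move=> /matrixP/(_ (enum_rank x) (enum_rank y)).
  rewrite !mxE (eq_bigr (fun z =>
    s x (enum_val z) * s (enum_val z) y)) => [|u _].
    rewrite (sum_enum_val (fun z => s x z * s z y)) !enum_rankK => e.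
    by do 2!apply: (mulfI (invr_neq0 nn0)); rewrite e (mulKf nn0).
  by rewrite !mxE !enum_rankK.
have ge0 u : 0 <= 1 - s x u * s u y * s x y.
  by case: (spm x u) => ->; case: (spm u y) => ->; case: (spm x y) => ->; lra.
have /eqP : \sum_u (1 - s x u * s u y * s x y) = 0.
  rewrite sumrB sumr_const -mulr_suml conv.
  by case: (spm x y) => ->; ring.
rewrite psumr_eq0 // => /allP/(_ z); rewrite mem_index_enum => /(_ isT) /eqP.
by rewrite -!/(s _ _); case: (spm x z) => ->; case: (spm z y) => ->;
  case: (spm x y) => ->; lra.
Qed.

Lemma card_sig_set (S A : pred X) :
  #|[set u : {x | S x} | A (val u)]| = #|[set x | S x && A x]|.
Proof.
rewrite -(card_imset _ val_inj); apply: eq_card => x; rewrite inE.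
apply/imsetP/andP => [[u]|[Sx Ax]].
  by rewrite inE => Au ->; split=> //; exact: valP u.
by exists (exist _ x Sx); rewrite ?inE.
Qed.

(** The sign of Q_3 relative to a base vertex separates points from blocks: relations 0 and 2 stay
    on one side, 1 and 3 cross. *)
Lemma tight_design : dual_tight q theta -> is_symmetric_design_graph (r i1).
Proof.
move=> tight; have sw := tight_switching tight.
have [k1 k3] := tight_valencies tight.
have [_ _ _ _ [w0 w1 w2 w3]] := tight_values tight.
have [x0 _] := cE ord0.
pose S x := (c x0 x == ord0) || (c x0 x == i2).
have SP x : Q i3 (c x0 x) = if S x then 1 else -1.
  rewrite /S; move: (c x0 x); apply: ord4P; rewrite ?eqxx ?orbT //.
    by rewrite eq_sym (negPf ne01) (negPf ne12).
  by rewrite eq_sym (negPf ne03) [i3 == _]eq_sym (negPf ne23).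
have pm1 : (1 : R) != -1 by rewrite -subr_eq0 opprK (pnatr_eq0 R 2).
have sS x y : Q i3 (c x y) = if S x == S y then 1 else -1.
  rewrite -(sw x y x0) (cC x x0) !SP.
  by case: (S x); case: (S y); rewrite ?mulr1 ?mulrN1 ?opprK.
have cS1 x y : c x y = i1 -> S x != S y.
  move=> cxy; move: (sS x y); rewrite cxy w1; case: eqP => // _ e.
  by rewrite e eqxx in pm1.
have cS2 x y : S x = S y -> x != y -> c x y = i2.
  move=> Sxy; rewrite -c0; move: (sS x y); rewrite Sxy eqxx.
  move: (c x y); apply: ord4P; rewrite ?eqxx ?w1 ?w3 // => e;
    by rewrite e eqxx in pm1.
(* Orthogonality of Q_0 and Q_3 makes the two sides equally large. *)
have kS : (k ord0 + k i2 = k i1 + k i3)%N.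
  have := orth ord0 i3; rewrite (negPf ne03) !mul0r /moment !sum_ord4.
  rewrite !(Q_0 cE EP EQ) w0 w1 w2 w3 (valency0 c0 cC cE cp) => e.
  by apply/eqP; rewrite -(eqr_nat R) !natrD; apply/eqP; lra.
have ball2 i j : i != j -> #|[pred z | (c x0 z == i) || (c x0 z == j)]| =
    (k i + k j)%N.
  move=> ij; rewrite -!(card_ball c0 cC cp x0) -cardsUI.
  have -> : [set z | c x0 z == i] :&: [set z | c x0 z == j] = set0.
    by apply/setP => z; rewrite !inE; case: eqP => //= ->; exact/negbTE.
  by rewrite cards0 addn0; apply: eq_card => z; rewrite !inE.
pose P := {x : X | S x}; pose B := {x : X | ~~ S x}.
have cardP : #|{: P}| = (k i1 + k i3)%N.
  rewrite card_sig -kS -(ball2 _ _ ne02).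
  by apply: eq_card.
have cardB : #|{: B}| = (k i1 + k i3)%N.
  rewrite card_sig -(ball2 _ _ ne13); apply: eq_card => x.
  rewrite !inE /S; move: (c x0 x); apply: ord4P; rewrite ?eqxx ?orbT //.
  - by rewrite (negPf ne01) (negPf ne03).
  - by rewrite eq_sym (negPf ne01) (negPf ne12).
  - by rewrite eq_sym (negPf ne12) (negPf ne23).
  - by rewrite eq_sym (negPf ne03) [i3 == i2]eq_sym (negPf ne23).
pose inc (x : P) (b : B) := r i1 (val x) (val b).
(* Distinct points are in relation 2, whence l = p^2_{11}; the bound k + 1 < v becomes k_3 > 1. *)
exists P, B, inc, (k i1 + k i3)%N, (k i1), (p i2 i1 i1); split.
  split=> //.
  - by rewrite k1 -addn1 ltn_add2l k3.
  - move=> b; rewrite (card_sig_set _ (fun x => r i1 x (val b))).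
    rewrite -(card_ball c0 cC cp (val b)); apply: eq_card => x.
    rewrite !inE rc (cC x); apply: andb_idl => /eqP /cS1.
    by have := valP b; rewrite -[val b]/(sval b); do 2!case: (S _).
  - move=> x y xy.
    rewrite (card_sig_set _ (fun b => r i1 (val x) b && r i1 (val y) b)).
    rewrite -(_ : c (val x) (val y) = i2); last first.
      by apply: cS2; rewrite ?(valP x) ?(valP y).
    rewrite -cp; apply: eq_card => z; rewrite !inE !rc (cC z).
    apply: andb_idl => /andP[/eqP/cS1 + _].
    by rewrite (valP x); case: (S z).
pose f (u : P + B) : X := match u with inl x => val x | inr b => val b end.
exists f.
  apply: inj_card_bij.
    move=> [x|b] [y|d] /= e; try by congr (_ _); apply: val_inj.
      by have := valP x; rewrite /= e (negPf (valP d)).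
    by have := valP y; rewrite /= -e (negPf (valP b)).
  rewrite card_sum !card_sig -(cardC S); apply: leq_add; apply: eq_leq;
    exact: eq_card.
have same_side x y : S x = S y -> r i1 x y = false.
  by move=> Sxy; rewrite rc; apply/negP => /eqP/cS1; rewrite Sxy eqxx.
move=> [x|b] [y|d] //=.
- by apply: same_side; rewrite (valP x) (valP y).
- by rewrite /inc !rc cC.
- by apply: same_side; rewrite (negPf (valP b)) (negPf (valP d)).
Qed.

(** * From a symmetric design to dual-tightness *)

(** Recovers the other relations from incidence: [j] joins distinct vertices of one side and [g]
    joins the non-incident pairs. *)
Lemma design_relations i : i <> ord0 -> is_symmetric_design_graph (r i) ->
  exists j g, uniq [:: ord0; j; i; g] /\ exists s : X -> bool,
    [/\ forall x y, (c x y \in [:: ord0; j]) = (s x == s y),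
        (1 < k i)%N & (k i < k j)%N].
Proof.
move=> i0 [P [B [inc [v [d [l [des [f fb iso]]]]]]]].
have [[vP vB] /andP[d1 dv] inc_d inc_l] := des.
have fI := bij_inj fb; have [g fg gf] := fb.
have cI u w : (c (f u) (f w) == i) = incidence_graph inc u w.
  by rewrite -iso rc.
have card_f (A : {set P + B}) : #|[set x | g x \in A]| = #|A|.
  rewrite -(card_imset A fI); apply: eq_card => x; rewrite inE.
  apply/idP/imsetP => [gx|[u Au ->]]; last by rewrite fg.
  by exists (g x).
pose inlS (A : {set P}) : {set P + B} :=
  [set u | if u is inl y then y \in A else false].
pose inrS (A : {set B}) : {set P + B} :=
  [set u | if u is inr y then y \in A else false].
have card_inl A : #|inlS A| = #|A|.
  rewrite -(card_imset A (@inl_inj P B)); apply: eq_card => -[y|y]; rewrite inE.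
    by rewrite (mem_imset _ _ (@inl_inj P B)).
  by apply/esym/imsetP => -[].
have card_inr A : #|inrS A| = #|A|.
  rewrite -(card_imset A (@inr_inj P B)); apply: eq_card => -[y|y]; rewrite inE.
    by apply/esym/imsetP => -[].
  by rewrite (mem_imset _ _ (@inr_inj P B)).
have v0 : (0 < v)%N by apply: leq_trans dv.
have [b0 _] : exists b0 : B, true.
  by have := v0; rewrite -vB => /card_gt0P[b]; exists b.
have ki : k i = d.
  rewrite -(inc_d b0) -card_inl -card_f -(card_ball c0 cC cp (f (inr b0))).
  apply: eq_card => x; rewrite !inE -{1}(gf x) cI.
  by case: (g x) => // y; rewrite inE.
have [p0 [p1 [p01 inc0 inc1]]] :
    exists p0 p1, [/\ p0 != p1, inc p0 b0 & inc p1 b0].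
  have := d1; rewrite -(inc_d b0) => /card_gt1P[y [z []]].
  by rewrite !inE => hy hz yz; exists y, z.
(* The block [b0] has at least two points, and these lie on it together. *)
have l0 : (0 < l)%N.
  rewrite -(inc_l _ _ p01) card_gt0; apply/set0Pn; exists b0.
  by rewrite inE inc0.
have pPP y z : y != z -> p (c (f (inl y)) (f (inl z))) i i = l.
  move=> yz; rewrite -cp -(inc_l _ _ yz) -card_inr -card_f; apply: eq_card => x.
  rewrite !inE -{1 2}(gf x) cI cC cI; case: (g x) => //= b; by rewrite inE.
have pPB y b : p (c (f (inl y)) (f (inr b))) i i = 0%N.
  rewrite -cp; apply/eqP; rewrite cards_eq0; apply/eqP/setP => x.
  by rewrite !inE -(gf x) cI cI; case: (g x) => //= z; rewrite ?andbF.
have [p2 ninc] : exists p2, ~~ inc p2 b0.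
  apply/existsP; apply: contraT; rewrite negb_exists => /forallP inc_all.
  have : #|[set y | inc y b0]| = v.
    by rewrite -vP; apply: eq_card => y; rewrite !inE; exact: negbNE.
  by rewrite inc_d => dv'; move: dv; rewrite dv' ltnNge leqnSn.
set j := c (f (inl p0)) (f (inl p1)).
set h := c (f (inl p2)) (f (inr b0)).
have PB_ne0 y b : c (f (inl y)) (f (inr b)) != ord0.
  by rewrite c0 (inj_eq fI).
(* Two points have l > 0 common neighbours and a point and a block have none, so their relations
   differ. *)
have PP_ne y z y' b : y != z ->
    c (f (inl y)) (f (inl z)) != c (f (inl y')) (f (inr b)).
  move=> yz; apply: contraTneq l0 => e.
  by rewrite -(pPP _ _ yz) e pPB.
have PP_ne0 y z : y != z -> c (f (inl y)) (f (inl z)) != ord0.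
  by move=> yz; rewrite c0 (inj_eq fI).
have PP_nei y z : c (f (inl y)) (f (inl z)) != i.
  by rewrite cI.
have un : uniq [:: ord0; j; i; h].
  rewrite /= !inE !negb_or !andbT ![ord0 == _]eq_sym.
  rewrite PP_ne0 //; rewrite PB_ne0 PP_nei PP_ne // (introN eqP i0) /=.
  rewrite [i == _]eq_sym.
  by rewrite cI /= ninc.
have PPj y z : y != z -> c (f (inl y)) (f (inl z)) = j.
  move=> yz; have := cover4 (c (f (inl y)) (f (inl z))) un.
  rewrite !inE (negPf (PP_ne0 _ _ yz)) (negPf (PP_nei _ _)).
  rewrite (negPf (PP_ne _ _ _ _ yz)).
  by rewrite !orbF => /eqP.
have PBj y b : c (f (inl y)) (f (inr b)) != j by rewrite eq_sym PP_ne.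
have kj : (k j).+1 = v.
  rewrite -(card_ball c0 cC cp (f (inl p0))).
  rewrite (_ : #|[set z | c (f (inl p0)) z == j]| = #|[set~ p0]|).
    by rewrite cardsC1 vP prednK.
  rewrite -card_inl -card_f; apply: eq_card => x; rewrite !inE -{1}(gf x).
  case: (g x) => [y|b]; last by rewrite (negPf (PBj _ _)).
  rewrite !inE; have [->|yp] := eqVneq y p0; last first.
    by rewrite PPj ?eqxx // eq_sym.
  apply/negP => /eqP e; have := PP_ne0 _ _ p01; rewrite -/j -e.
  by rewrite c0 eqxx.
(* All [j]-neighbours of a block are other blocks, and there are k_j = v - 1 of each. *)
have BBj b b' : b != b' -> c (f (inr b)) (f (inr b')) = j.
  move=> bb; have sub : [set x | c (f (inr b)) x == j] \subset
      [set x | g x \in inrS [set~ b]].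
    apply/subsetP => x; rewrite !inE -{1}(gf x); case: (g x) => [y|y].
      by rewrite cC (negPf (PBj _ _)).
    rewrite !inE => /eqP e; apply: contraTneq isT => yb; move: e; rewrite yb.
    move=> e; have := PP_ne0 _ _ p01; rewrite -/j -e.
    by rewrite c0 eqxx.
  have : [set x | c (f (inr b)) x == j] ==
      [set x | g x \in inrS [set~ b]].
    rewrite eqEcard sub card_f card_inr cardsC1 vB (card_ball c0 cC cp).
    by rewrite -kj leqnn.
  move=> /eqP/setP/(_ (f (inr b'))).
  by rewrite !inE fg !inE [b' == b]eq_sym bb => /eqP.
exists j, h; split=> //; exists (fun x => if g x is inl _ then true else false).
split; last 2 first.
- by rewrite ki.
- by rewrite -ltnS kj ki.
move=> x y; rewrite !inE -{1 2}(gf x) -{1 2}(gf y).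
case: (g x) => [u|u]; case: (g y) => [w|w].
- rewrite c0 (inj_eq fI); have [->|uw] := eqVneq u w; first by rewrite eqxx.
  by rewrite PPj ?eqxx ?orbT.
- by rewrite (negPf (PB_ne0 _ _)) (negPf (PBj _ _)).
- by rewrite cC (negPf (PB_ne0 _ _)) (negPf (PBj _ _)).
- rewrite c0 (inj_eq fI); have [->|uw] := eqVneq u w; first by rewrite eqxx.
  by rewrite BBj ?eqxx ?orbT.
Qed.

Lemma design_dual_tight i : i <> ord0 -> is_symmetric_design_graph (r i) ->
  dual_tight q theta.
Proof.
move=> i0 des; have [j [g [un [s [sP k1 kij]]]]] := design_relations i0 des.
have cov h := cover4 h un.
pose eps h : R := if h \in [:: ord0; j] then 1 else -1.
have epsM x y z : eps (c x z) * eps (c z y) = eps (c x y).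
  rewrite /eps !sP; case: (s x); case: (s z); case: (s y);
    by rewrite /= ?mulr1 ?mul1r ?mulrNN ?mulr1.
have eps0 : eps ord0 = 1 by rewrite /eps inE eqxx.
have epsj : eps j = 1 by rewrite /eps !inE eqxx orbT.
move: un; rewrite /= !inE !negb_or.
case/and4P=> /and3P[j0 i0' g0] /andP[ji jg] ig _.
have epsi : eps i = -1.
  by rewrite /eps !inE ![i == _]eq_sym (negPf i0') (negPf ji).
have epsg : eps g = -1.
  by rewrite /eps !inE ![g == _]eq_sym (negPf g0) (negPf jg).
have [[row1 row2 row3] [b10 b20 c20 c30]] := (krein_rows, q_off_diagonal).
have qge := q_ge0 rc c0 cC cE cp EP EQ qP.
have m0 := lt0r_neq0 m_gt0.
have th_inj x y : x != y -> Q i1 x != Q i1 y.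
  rewrite -!theta_Q -val_eqE neq_ltn => /orP[] /theta_dec lt;
    by rewrite ?(lt_eqF lt) ?(gt_eqF lt).
have [l lE] := switching_idempotent rc c0 cC cE cp EP EQ eps0 epsM.
have kr := switching_krein rc cC cE cp EP EQ qP epsM.
(* The index l is not 0, as [eps] takes the value -1, and not 1, as Q_1 is injective while [eps] is
   1 at both 0 and [j]. *)
have Q3 : Q i3 =1 eps.
  move: l lE; apply: ord4P => lE //.
  - have := lE i; rewrite (Q_0 cE EP EQ) epsi => e.
    have : (2 : R) = 0 by lra.
    by move/eqP; rewrite pnatr_eq0.
  - by have := th_inj _ _ j0; rewrite !lE eps0 epsj eqxx.
  (* For l = 2, the nonzero b1 and c3 would both be 1, and the second equation at relation 0 would
     read 0 = a2 + Q_3(0), against positivity. *)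
  - have b11 : b1 = 1 by case: (kr i1 i2 i1 lE) => // e; rewrite e eqxx in b10.
    have c31 : c3 = 1 by case: (kr i1 i2 i3 lE) => // e; rewrite e eqxx in c30.
    have [_ e _] := krein_rec ord0; rewrite b11 c31 lE eps0 in e.
    have := qge i1 i2 i2; have := w_gt0; lra.
have w01 : Q i3 ord0 = 1 by rewrite Q3.
have b21 : b2 = 1 by case: (kr i1 i3 i2 Q3) => // e; rewrite e eqxx in b20.
(* As Q_3^2 = 1, the triple moment of Q_1, Q_3, Q_3 is the moment of Q_1 alone, which is 0. *)
have a30 : a3 = 0.
  apply: (mulIf (mulf_neq0 nn0 (lt0r_neq0 w_gt0))).
  rewrite mulrA -(moment3E rc c0 cC cE cp EP EQ qP) mul0r.
  rewrite (momentE p (g := fun h => Q ord0 h * Q i1 h)) => [|h].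
    by rewrite orth (negPf ne01) !mul0r.
  by rewrite -mulrA !Q3 (switching_sqr c0 cC cE eps0 epsM) (Q_0 cE EP EQ) mulrC.
(* Now Q_2 = Q_1 eps, so each dual eigenvalue solves a quadratic depending on its sign: m and -1 for
   relations 0 and [j], the roots of the other for [i] and [g]. *)
have quad h : Q i1 h ^+ 2 = m + a * Q i1 h + c2 * eps h * Q i1 h.
  have [e1 _ e3] := krein_rec h; rewrite e1.
  rewrite b21 a30 mul1r mul0r addr0 Q3 in e3.
  by rewrite -e3; ring.
have c2E : c2 = m - 1 - a.
  have := quad ord0; rewrite eps0 => e; apply: (mulfI m0).
  have -> : m * c2 = (m ^+ 2 - m - a * m) by rewrite e; ring.
  by ring.
have yE : Q i1 j = -1.
  have := quad j; rewrite epsj c2E => e; apply/eqP; rewrite -subr_eq0 opprK.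
  have : (Q i1 j - m) * (Q i1 j + 1) == 0.
    have -> : (Q i1 j - m) * (Q i1 j + 1) = Q i1 j ^+ 2 + (1 - m) * Q i1 j - m.
      by ring.
    by rewrite e; apply/eqP; ring.
  by rewrite mulf_eq0 subr_eq0 eq_sym (negPf (th_inj _ _ j0)).
have xi := quad i; have xg := quad g; rewrite epsi c2E in xi.
rewrite epsg c2E in xg.
have xs : Q i1 i + Q i1 g = 2 * a + 1 - m.
  have d : Q i1 i - Q i1 g != 0 by rewrite subr_eq0 th_inj.
  apply: (mulfI d).
  have -> : (Q i1 i - Q i1 g) * (Q i1 i + Q i1 g) =
    Q i1 i ^+ 2 - Q i1 g ^+ 2 by ring.
  by rewrite xi xg; ring.
have xp : Q i1 i * Q i1 g = - m.
  have -> : Q i1 i * Q i1 g = Q i1 i * (Q i1 i + Q i1 g) - Q i1 i ^+ 2 by ring.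
  by rewrite xs xi; ring.
have sum4 (F : 'I_4 -> R) : \sum_h F h = F ord0 + F j + F i + F g.
  rewrite (bigD1 ord0) //= (bigD1 j) /= 1?eq_sym // (bigD1 i) /=; last first.
    by rewrite ![i == _]eq_sym i0' ji.
  rewrite (bigD1 g) /=; last by rewrite ![g == _]eq_sym g0 jg ig.
  rewrite big1 ?addr0 ?addrA // => h.
  by have := cov h; rewrite !inE; do 4!case: eqP => //.
apply/dual_tightE; split; last first.
  suff [ts tp] : theta i1 + theta i3 = 2 * a + 1 - m /\
      theta i1 * theta i3 = - m.
    by rewrite ts tp; ring.
  have lt0 h : h != ord0 -> Q i1 h < m.
    rewrite -!theta_Q => h0; apply: theta_dec.
    by rewrite lt0n; apply: contraNneq h0 => e; apply/eqP/val_inj.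
  have ltm (x y : 'I_4) : (x < y)%N -> Q i1 y < Q i1 x.
    by move=> xy; rewrite -!theta_Q theta_dec.
  have l1 : Q i1 i1 < m by apply: lt0; rewrite eq_sym.
  have l2 : Q i1 i2 < Q i1 i1 by apply: ltm; rewrite !inordK.
  have l3 : Q i1 i3 < Q i1 i2 by apply: ltm; rewrite !inordK.
  (* The position of [j] among 1, 2, 3 is unknown, so only symmetric functions are transferred;
     [middle_root] then puts -1 in the middle. *)
  have S1 : Q i1 i1 + Q i1 i2 + Q i1 i3 = Q i1 j + (Q i1 i + Q i1 g).
    by have := sum4 (Q i1); rewrite sum_ord4; lra.
  have S2 : Q i1 i1 ^+ 2 + Q i1 i2 ^+ 2 + Q i1 i3 ^+ 2 =
      Q i1 j ^+ 2 + (Q i1 i + Q i1 g) ^+ 2 - 2 * (Q i1 i * Q i1 g).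
    have := sum4 (fun h => Q i1 h ^+ 2); rewrite sum_ord4 => e.
    have -> : Q i1 j ^+ 2 + (Q i1 i + Q i1 g) ^+ 2 - 2 * (Q i1 i * Q i1 g) =
      Q i1 j ^+ 2 + Q i1 i ^+ 2 + Q i1 g ^+ 2 by ring.
    lra.
  rewrite xs xp yE in S1 S2.
  rewrite !theta_Q; apply: middle_root m_gt0 l1 l2 l3 _ S1 _.
    move: j0 yE; move: (j); apply: ord4P => [/eqP //|||] _ ->;
      by rewrite !inE eqxx ?orbT.
  by rewrite S2; ring.
(* With a = 0, the value of Q_1 at [i] is 1 or - m, which forces k_i = m = k_j or k_i = 1. Both
   contradict 1 < k_i < k_j, the non-degeneracy of the design. *)
move=> /(_ i1); rewrite /astar => az.
have orth' u h : u != h -> \sum_t (k t)%:R * (Q u t * Q h t) = 0.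
  by move=> uh; have := orth u h; rewrite (negPf uh) !mul0r.
have o1 := orth' _ _ ne01; have o2 := orth' _ _ ne03; have o3 := orth' _ _ ne13.
rewrite !sum4 !(Q_0 cE EP EQ) (valency0 c0 cC cE cp) ?Q3 ?eps0 ?epsi
  ?epsj ?epsg ?yE in o1 o2 o3.
have kj : (k j)%:R = m :> R by lra.
have kg : (k i)%:R + (k g)%:R = 1 + m :> R by lra.
have kx : (k i)%:R * Q i1 i = - ((k g)%:R * Q i1 g) :> R by lra.
have ki1 : 1 < (k i)%:R :> R by rewrite ltr1n.
have kim : (k i)%:R < m :> R by rewrite -kj ltr_nat.
have : (Q i1 i - 1) * (Q i1 i + m) == 0.
  by apply/eqP; rewrite az in xi; have := xi; nra.
rewrite az in xs; rewrite mulf_eq0 => /orP[] /eqP e.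
  have e1 : Q i1 i = 1 by lra.
  have e2 : Q i1 g = - m by lra.
  have kig : (k i)%:R = (k g)%:R * m by rewrite e1 e2 in kx; lra.
  have [kim' _] := split_proportion m_gt0 kg kig.
  by rewrite kim' ltxx in kim.
have e1 : Q i1 i = - m by lra.
have e2 : Q i1 g = 1 by lra.
have kgi : (k g)%:R = (k i)%:R * m by rewrite e1 e2 in kx; lra.
rewrite addrC in kg; have [_ ki1'] := split_proportion m_gt0 kg kgi.
by rewrite ki1' ltxx in ki1.
Qed.

End Class3.

Theorem theorem5p1 (R : rcfType) (X : finType) (r : 'I_4 -> rel X)
    (E : 'I_4 -> 'M[R]_#|X|) (q : 'I_4 -> 'I_4 -> 'I_4 -> R)
    (theta : 'I_4 -> R) :
  association_scheme r ->
  primitive_idempotents r E ->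
  krein_parameters E q ->
  dual_eigenvalues r E theta ->
  q_polynomial q ->
  dual_eigenvalues_decreasing theta ->
  dual_tight q theta <->
  exists i : 'I_4, i <> ord0 /\ is_symmetric_design_graph (r i).
Proof.
move=> sch EP qP thP qpoly dec.
have [c [rc c0 cC cE [p cp]]] := relation_index sch.
have [Q EQ] : exists Q : 'I_4 -> 'I_4 -> R,
    forall j, E j = #|X|%:R^-1 *: bm c (Q j).
  apply: (fin_all_exists (U := fun=> 'I_4 -> R)
    (P := fun j Qj => E j = #|X|%:R^-1 *: bm c Qj)) => j.
  have [_ /(_ j)[[/(bmP rc)[f ->] _] _ _] _] := EP.
  exists (fun h => #|X|%:R * f h); rewrite bmZ; apply/matrixP => x y.
  by rewrite !mxE mulKf // (n_neq0 R cE).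
split=> [tight|[i [i0 des]]].
  exists (inord 1); split; last first.
    exact: (tight_design rc c0 cC cE cp EP EQ qP thP qpoly dec tight).
  by move/(congr1 val); rewrite /= inordK.
exact: (design_dual_tight rc c0 cC cE cp EP EQ qP thP qpoly dec i0 des).
Qed.
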